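(* For real $t$ with $|t|<1/4$, define $$h_t(e^{i\theta})=e^{i(\theta+t\sin2\theta)} .$$ Then $h_t$ is a normalized quasisymmetric homeomorphism of $S^1$, $h_t\to\mathrm{id}$ in the Teichmüller metric as $t\to0$, and $$\liminf_{t\to0,\,t\ne0}\|V_{h_t}-I\|_{\mathrm e}\ge\sqrt2 .$$
   Context: An orientation-preserving homeomorphism $h:S^1\to S^1$ of the unit circle is quasisymmetric if there is $M\ge1$ with $M^{-1}\le |h(I_1)|/|h(I_2)|\le M$ whenever $I_1,I_2$ are adjacent arcs of equal length ($|I|$ denotes arc length). It is normalized if it fixes $1$, $i$ and $-1$. The Teichmüller distance is $\tau([h_1],[h_2])=\frac12\inf_F\log K(F)$, $K(F)=\frac{1+\|\mu_F\|_\infty}{1-\|\mu_F\|_\infty}$, $\mu_F=\bar\partial F/\partial F$, the infimum being over quasiconformal self-homeomorphisms $F$ of the unit disk $\mathbb D$ with boundary values $h_2\circ h_1^{-1}$ (here $[h]$ is the class of $h$ modulo post-composition $h\mapsto m\circ h$ with boundary values $m$ of conformal automorphisms of $\mathbb D$); ''$h_t\to\mathrm{id}$ in the Teichmüller metric'' means $\tau([h_t],[\mathrm{id}])\to0$. $H^{1/2}(S^1)$ is the Hilbert space of (classes modulo constants of) complex-valued functions $u$ on $S^1$ with $\|u\|_{H^{1/2}}^2=\sum_{n\ne0}|n||\widehat u(n)|^2<\infty$. For quasisymmetric $h$, $V_hu=u\circ h$ is a bounded invertible operator on $H^{1/2}(S^1)$. The essential norm of a bounded operator $T$ is $\|T\|_{\mathrm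 e}=\inf\{\|T-K\|:K\text{ compact}\}$. *)

(* Defs.v *)
From HB Require Import structures.
From mathcomp Require Import all_boot all_order all_algebra.
From mathcomp Require Import complex.
From mathcomp Require Import all_classical all_reals all_analysis.
From mathcomp Require Import ess_sup_inf.

Set Implicit Arguments.
Unset Strict Implicit.
Unset Printing Implicit Defensive.

Import Order.TTheory GRing.Theory Num.Theory.
Import numFieldNormedType.Exports.

Local Open Scope classical_set_scope.
Local Open Scope ring_scope.
Local Open Scope complex_scope.

(* The topology of the complex plane given by the modulus. *)
HB.instance Definition _ (R : realType) :=
  PseudoMetricNormedZmod.copy R[i] (R[i]^o).

Section circle.
Context {R : realType}.
Local Notation C := R[i].

Definition cabs (z : C) : R := complex.Re `|z|.

Definition expi (x : R) : C := cos x +i* sin x.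

Definition S1 : set C := [set z | cabs z = 1].

Definition disk : set C := [set z | cabs z < 1].

(* Maps between subsets of the plane are total functions on [C]; only their
   values on the source set are meaningful. *)
Definition homeomorphism (A B : set C) (f : C -> C) :=
  [/\ set_bij A B f, {within A, continuous f} &
      {within B, continuous (pinv A f)}].

(* [h] has an increasing continuous lift to the universal cover of the circle. *)
Definition orientation_preserving (h : C -> C) :=
  exists f : R -> R, [/\ continuous f, {homo f : x y / x < y} &
    forall x, h (expi x) = expi (f x)].

Definition arc (a b : R) : set C := expi @` `[a, b].

Definition adjacent_arcs (I1 I2 : set C) :=
  exists a b c : R, [/\ a < b, b < c, c <= a + 2 * pi,
    I1 = arc a b & I2 = arc b c].

Definition arclength (A : set C) : R :=
  fine (lebesgue_measure (`[0, 2 * pi[ `&` expi @^-1` A : set R)).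

Definition quasisymmetric (h : C -> C) :=
  [/\ homeomorphism S1 S1 h, orientation_preserving h &
      exists2 M : R, 1 <= M & forall I1 I2 : set C,
        adjacent_arcs I1 I2 -> arclength I1 = arclength I2 ->
        M^-1 <= arclength (h @` I1) / arclength (h @` I2) <= M].

Definition normalized (h : C -> C) :=
  [/\ h 1 = 1, h 'i = 'i & h (- 1) = - 1].

End circle.

Section quasiconformal.
Context {R : realType}.
Local Notation C := R[i].

Definition abs_continuous (a b : R) (f : R -> C) :=
  forall e : R, 0 < e -> exists2 d : R, 0 < d &
    forall s : seq (R * R),
      all (fun p => (a <= p.1) && (p.1 <= p.2) && (p.2 <= b)) s ->
      pairwise (fun p q => p.2 <= q.1) s ->
      \sum_(p <- s) (p.2 - p.1) < d ->
      \sum_(p <- s) cabs (f p.2 - f p.1) < e.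

(* Absolute continuity on almost every horizontal and almost every vertical
   segment of each closed rectangle in [D]. *)
Definition ACL (D : set C) (F : C -> C) :=
  forall a b c d : R, a < b -> c < d ->
    (forall x y, a <= x <= b -> c <= y <= d -> D (x +i* y)) ->
    {ae lebesgue_measure, forall y : R, c <= y <= d ->
       abs_continuous a b (fun x => F (x +i* y))} /\
    {ae lebesgue_measure, forall x : R, a <= x <= b ->
       abs_continuous c d (fun y => F (x +i* y))}.

Definition cderive1 (f : R -> C) (x : R) : C :=
  derive1 (fun t => complex.Re (f t)) x +i* derive1 (fun t => complex.Im (f t)) x.

Definition partial_x (F : C -> C) (z : C) : C :=
  cderive1 (fun x => F (x +i* complex.Im z)) (complex.Re z).

Definition partial_y (F : C -> C) (z : C) : C :=
  cderive1 (fun y => F (complex.Re z +i* y)) (complex.Im z).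

Definition dz (F : C -> C) (z : C) : C :=
  (partial_x F z - 'i * partial_y F z) / 2.

Definition dzbar (F : C -> C) (z : C) : C :=
  (partial_x F z + 'i * partial_y F z) / 2.

Definition plane_measure :
    {measure set (measurableTypeR R * measurableTypeR R) -> \bar R} :=
  (@lebesgue_measure R \x @lebesgue_measure R)%E.

(* The analytic definition (Ahlfors, definition B). The ACL property makes the
   partial derivatives exist almost everywhere in the disk, so the default
   value of [derive1] only matters on a null set. *)
Definition quasiconformal (F : C -> C) :=
  [/\ homeomorphism disk disk F, ACL disk F &
      exists2 k : R, 0 <= k < 1 &
        {ae plane_measure, forall p : R * R, disk (p.1 +i* p.2) ->
           cabs (dzbar F (p.1 +i* p.2)) <= k * cabs (dz F (p.1 +i* p.2))}].

Definition beltrami (F : C -> C) (z : C) : C := dzbar F z / dz F z.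

(* [mu_F] lives on the disk; it is extended by 0 to take the essential
   supremum over the plane. *)
Definition beltrami_norm (F : C -> C) : R :=
  fine (ess_sup plane_measure (fun p =>
    (cabs (beltrami F (p.1 +i* p.2)) * \1_disk (p.1 +i* p.2))%:E)).

Definition dilatation (F : C -> C) : R :=
  (1 + beltrami_norm F) / (1 - beltrami_norm F).

Definition boundary_values (F g : C -> C) :=
  forall w : C, S1 w -> F z @[z --> within disk (nbhs w)] --> g w.

(* The distance between the classes of [h1] and [h2], computed on
   representatives. It is extended real valued so that the infimum over an
   empty set is [+oo]. *)
Definition teichmuller_distance (h1 h2 : C -> C) : \bar R :=
  ((2^-1)%:E * ereal_inf [set (ln (dilatation F))%:E | F in
     [set F | quasiconformal F /\
              boundary_values F (h2 \o pinv S1 h1)]])%E.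

End quasiconformal.

(* The Hilbert space H^{1/2}(S^1) is handled through representatives: [H12norm]
   is a seminorm on the functions in [H12], which vanishes exactly on the
   functions that are almost everywhere constant. An operator on the quotient
   is a map on representatives whose algebraic laws hold up to [H12norm]-null
   functions. *)
Section H12.
Context {R : realType}.
Local Notation C := R[i].
Local Notation I02pi := (`[0, 2 * pi]%classic : set R).

Definition circle_integrable (u : C -> C) :=
  lebesgue_measure.-integrable I02pi (fun x => (complex.Re (u (expi x)))%:E) /\
  lebesgue_measure.-integrable I02pi (fun x => (complex.Im (u (expi x)))%:E).

Definition circle_integral (u : C -> C) : C :=
  Rintegral lebesgue_measure I02pi (fun x => complex.Re (u (expi x))) +i*
  Rintegral lebesgue_measure I02pi (fun x => complex.Im (u (expi x))).

(* On the circle, [w ^ (- n)] is [e^{-in theta}]. *)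
Definition fourier (u : C -> C) (n : int) : C :=
  ((2 * pi)^-1)%:C * circle_integral (fun w => u w * w ^ (- n)).

Definition H12norm (u : C -> C) : \bar R :=
  sqrte (\esum_(n in [set n : int | n != 0])
    ((`|n|%N)%:R * cabs (fourier u n) ^+ 2)%:E).

Definition H12 : set (C -> C) :=
  [set u | circle_integrable u /\ (H12norm u < +oo)%E].

Definition bounded_operator (T : (C -> C) -> (C -> C)) :=
  [/\ forall u, H12 u -> H12 (T u),
      forall (a : C) u v, H12 u -> H12 v ->
        H12norm (fun w => T (fun w' => a * u w' + v w') w -
                          (a * T u w + T v w)) = 0%E &
      exists M : R, forall u, H12 u -> (H12norm (T u) <= M%:E * H12norm u)%E].

Definition compact_operator (T : (C -> C) -> (C -> C)) :=
  bounded_operator T /\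
  forall u : nat -> (C -> C),
    (forall n, H12 (u n) /\ (H12norm (u n) <= 1)%E) ->
    exists phi : nat -> nat, exists v : C -> C,
      [/\ {homo phi : m n / (m < n)%N}, H12 v &
          H12norm (fun w => T (u (phi n)) w - v w) @[n --> \oo] --> 0%E].

(* Extended real valued: [+oo] for an unbounded operator. *)
Definition operator_norm (T : (C -> C) -> (C -> C)) : \bar R :=
  ereal_sup [set H12norm (T u) | u in
    [set u | H12 u /\ (H12norm u <= 1)%E]].

Definition essential_norm (T : (C -> C) -> (C -> C)) : \bar R :=
  ereal_inf [set operator_norm (fun u w => T u w - K u w) | K in
    compact_operator].

(* Composition of representatives. It is compatible with almost everywhere
   equality when [h] is bi-Lipschitz on the circle; for a singular [h] one would
   have to restrict to good (e.g. continuous) representatives. *)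
Definition composition_operator (h : C -> C) (u : C -> C) : C -> C := u \o h.

End H12.

(* Main.v *)
Require Import Defs.
From mathcomp Require Import all_boot all_order all_algebra.
From mathcomp Require Import complex.
From mathcomp Require Import all_classical all_reals all_analysis.
From mathcomp Require Import measurable_realfun ess_sup_inf.
From mathcomp Require Import ring lra zify.
Set Implicit Arguments.
Unset Strict Implicit.
Unset Printing Implicit Defensive.
Import Order.TTheory GRing.Theory Num.Theory.
Import numFieldNormedType.Exports.
Local Open Scope classical_set_scope.
Local Open Scope ring_scope.
Local Open Scope complex_scope.

(** The map $h_t$ is the projection to the circle of the lift
    $\phi(x)=x+t\sin 2x$, which distorts lengths by a factor between $1-2|t|$ and
    $1+2|t|$. Quasisymmetry and the three fixed points follow at once
    ([circle_map_quasisymmetric], [circle_map_normalized]).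

    For the Teichmueller distance one extends $h_t^{-1}$ radially,
    $F(re^{i\theta})=re^{i\psi(\theta)}$ with $\psi=\phi^{-1}$. This $F$ is
    bi-Lipschitz because $h_t$ is bi-Lipschitz for chords, hence a homeomorphism
    of the disk that is absolutely continuous on lines, and in logarithmic
    coordinates it is $s+i\theta\mapsto s+i\psi(\theta)$. Therefore
    $|\mu_F|=|1-\psi'|/|1+\psi'|\le 2|t|$ off a null set
    ([radial_wirtinger], [radial_beltrami_bound]), which gives
    $0\le\tau\le 4|t|$ ([teichmuller_distance_bounds]).

    The bound for the essential norm holds for every $t\ne0$ with $|t|<1/4$
    ([essential_norm_ge]). It rests on the inequality
    $\sum|m||\widehat g(m)|^2\ge\sum m|\widehat g(m)|^2$, whose right-hand side
    is $\frac1{2\pi}\int(p\,dq-q\,dp)$ for $g=p+iq$, the enclosed area over $\pi$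
    ([area_le_H12sq]). Area is invariant under reparametrization of the circle,
    so for $u_n=(2n)^{-1/2}w^n$ the area forms of $u_n\circ h_t$ and of $u_n$
    coincide, and the cross term between these two functions is the mean of
    $\cos(nt\sin 2\theta)$, which tends to 0 as $n\to\infty$ since $t\ne0$
    ([oscillatory_avg_small]).

    A compact operator $K$ is removed by a difference of two modes:
    $K u_n$ has a Cauchy subsequence, so $\|K(u_a-u_b)\|$ is small for suitable
    $a$ and $b$ with $b$ far larger than $a$ ([compact_mode_pair]). The pair has
    norm at most 1, and when $a/b$ is small the interaction between the two
    modes is negligible, so that the area form of
    $(V_{h_t}-I)(u_a-u_b)$ is nearly 2 ([twisted_area_le]). Hence
    $\|V_{h_t}-I-K\|^2\ge2$. *)

(** * The modulus on the complex plane *)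

Section ComplexModulus.
Context {R : realType}.
Implicit Types (z w : R[i]) (x y t : R).

Lemma normc_cabs z : `|z| = (cabs z)%:C.
Proof. by case: z. Qed.

Lemma sqr_cabs z : cabs z ^+ 2 = complex.Re z ^+ 2 + complex.Im z ^+ 2.
Proof. by case: z => a b; rewrite /cabs /= sqr_sqrtr// addr_ge0 ?sqr_ge0. Qed.

Lemma cabs_ge0 z : 0 <= cabs z.
Proof. by case: z => a b; rewrite /cabs /= sqrtr_ge0. Qed.

Lemma cabsM z w : cabs (z * w) = cabs z * cabs w.
Proof.
by apply: complexI; rewrite rmorphM /= -!normc_cabs normrM.
Qed.

Lemma cabsD z w : cabs (z + w) <= cabs z + cabs w.
Proof. by rewrite -lecR rmorphD /= -!normc_cabs ler_normD. Qed.

Lemma cabsN z : cabs (- z) = cabs z.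
Proof. by rewrite /cabs normrN. Qed.

Lemma cabsBC z w : cabs (z - w) = cabs (w - z).
Proof. by rewrite -cabsN opprB. Qed.

Lemma cabs_dist z w : cabs z - cabs w <= cabs (z - w).
Proof. by rewrite lerBlDr -{1}(subrK w z) cabsD. Qed.

Lemma cabs0 : cabs (0 : R[i]) = 0.
Proof. by rewrite /cabs normr0. Qed.

Lemma cabs1 : cabs (1 : R[i]) = 1.
Proof. by rewrite /cabs normr1. Qed.

Lemma cabs_real x : cabs x%:C = `|x|.
Proof. by rewrite /cabs /= expr0n /= addr0 sqrtr_sqr. Qed.

Lemma cabs_eq0 z : (cabs z == 0) = (z == 0).
Proof.
rewrite -(normr_eq0 z) normc_cabs eq_complex /= eqxx andbT //.
Qed.

Lemma cabsV z : cabs (z^-1) = (cabs z)^-1.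
Proof.
have [->|z0] := eqVneq z 0; first by rewrite invr0 cabs0 invr0.
by apply: (@mulfI _ (cabs z)); rewrite ?cabs_eq0// -cabsM !divff ?cabs_eq0// cabs1.
Qed.

Lemma normr_Im_le z : `|complex.Im z| <= cabs z.
Proof.
rewrite -(ler_sqr (normr_ge0 _) (cabs_ge0 _)) sqr_cabs real_normK ?num_real//.
by rewrite lerDr sqr_ge0.
Qed.

Lemma cabs_le_ReIm z : cabs z <= `|complex.Re z| + `|complex.Im z|.
Proof.
rewrite -ler_sqr ?nnegrE ?addr_ge0 ?cabs_ge0// sqr_cabs.
rewrite sqrrD !real_normK ?num_real// lerD2r lerDl mulrn_wge0// mulr_ge0//.
Qed.

Lemma ReD z w : complex.Re (z + w) = complex.Re z + complex.Re w.
Proof. by case: z; case: w. Qed.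
Lemma ImD z w : complex.Im (z + w) = complex.Im z + complex.Im w.
Proof. by case: z; case: w. Qed.
Lemma ReN z : complex.Re (- z) = - complex.Re z.
Proof. by case: z. Qed.
Lemma ImN z : complex.Im (- z) = - complex.Im z.
Proof. by case: z. Qed.
Lemma ReM z w : complex.Re (z * w) =
  complex.Re z * complex.Re w - complex.Im z * complex.Im w.
Proof. by case: z; case: w. Qed.
Lemma ImM z w : complex.Im (z * w) =
  complex.Re z * complex.Im w + complex.Im z * complex.Re w.
Proof. by case: z; case: w => /= a b c d; rewrite addrC. Qed.

Lemma complex_ext z w : complex.Re z = complex.Re w ->
  complex.Im z = complex.Im w -> z = w.
Proof. by case: z w => [a b] [c d] /= -> ->. Qed.

(** * The exponential map onto the circle *)

Lemma cabs_expi x : cabs (expi x) = 1.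
Proof. by rewrite /cabs /= cos2Dsin2 sqrtr1. Qed.

Lemma expi_neq0 x : expi x != 0.
Proof. by rewrite -cabs_eq0 cabs_expi oner_eq0. Qed.

Lemma S1_expi x : S1 (expi x).
Proof. exact: cabs_expi. Qed.

Lemma expi0 : expi 0 = 1 :> R[i].
Proof. by rewrite /expi cos0 sin0. Qed.

Lemma expiD x y : expi (x + y) = expi x * expi y.
Proof.
apply: complex_ext; rewrite ?ReM ?ImM /= ?cosD ?sinD//.
by rewrite addrC.
Qed.

Lemma expiN x : expi (- x) = (expi x)^-1.
Proof.
apply: (mulfI (expi_neq0 x)); rewrite -expiD subrr expi0 divff//.
exact: expi_neq0.
Qed.

Lemma expiB x y : expi (x - y) = expi x / expi y.
Proof. by rewrite expiD expiN. Qed.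

Lemma expiX x (n : nat) : expi x ^+ n = expi (n%:R * x).
Proof.
elim: n => [|n IH]; first by rewrite expr0 mul0r expi0.
by rewrite exprS IH -expiD mulrSr mulrDl mul1r addrC.
Qed.

Lemma expi_exprz x (n : int) : expi x ^ n = expi (n%:~R * x).
Proof.
case: n => n /=; first by rewrite -exprnP expiX.
by rewrite NegzE -exprnN expiX -expiN mulrNz mulNr.
Qed.

Lemma expiD2pi x : expi (x + 2 * pi) = expi x.
Proof. by rewrite /expi mulr_natl sinD2pi cosD2pi. Qed.

Lemma expi2pi : expi (2 * pi) = 1 :> R[i].
Proof. by rewrite -[2 * pi]add0r expiD2pi expi0. Qed.

Lemma expi_period x (k : int) : expi (x + k%:~R * (2 * pi)) = expi x.
Proof. by rewrite expiD -expi_exprz expi2pi exp1rz mulr1. Qed.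

Lemma expipi : expi pi = -1 :> R[i].
Proof. by apply/eqP; rewrite /expi cospi sinpi eq_complex /= oppr0 !eqxx. Qed.

Lemma twopi_gt0 : 0 < 2 * pi :> R.
Proof. by rewrite mulr_gt0// pi_gt0. Qed.

Lemma mod2pi x : exists k : int, 0 <= x - k%:~R * (2 * pi) < 2 * pi.
Proof.
exists (Num.floor (x / (2 * pi))).
have p0 := twopi_gt0.
have := floor_itv (x / (2 * pi)).
rewrite ler_pdivlMr// ltr_pdivrMr// intrD mulrDl mul1r => /andP[h1 h2].
by apply/andP; split; lra.
Qed.

Lemma expi_eq1 x : 0 <= x < 2 * pi -> expi x = 1 -> x = 0.
Proof.
move=> /andP[x0 x2pi] [cx _]; apply/eqP; rewrite eq_le x0 andbT leNgt.
apply/negP => xgt0.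
have s0 : 0 < sin (x / 2) by apply: sin_gt0_pi; apply/andP; split; lra.
have : cos ((x / 2) *+ 2) = 1 by rewrite -mulr_natr divfK.
rewrite cos_mulr2n => h; have := cos2Dsin2 (x / 2).
by have := exprn_gt0 2 s0; rewrite mulr2n in h; lra.
Qed.

Lemma expi_inj x y : expi x = expi y ->
  exists k : int, x = y + k%:~R * (2 * pi).
Proof.
move=> exy; have [k hk] := mod2pi (x - y).
have e1 : expi (x - y - k%:~R * (2 * pi)) = 1.
  rewrite -mulNr -mulrNz expi_period expiB exy divff//.
  exact: expi_neq0.
by exists k; have := expi_eq1 hk e1; lra.
Qed.

Lemma expi_surj z : S1 z -> exists x, z = expi x.
Proof.
move=> z1; have := sqr_cabs z; rewrite z1 expr1n => ab1.
case: z z1 ab1 => a b _ /= ab1.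
have a1 : -1 <= a <= 1.
  by have := sqr_ge0 b; nra.
have sa := sin_acos a1.
have [b0|b0] := leP 0 b.
  exists (acos a); rewrite /expi acosK ?in_itv//= sa.
  suff -> : 1 - a ^+ 2 = b ^+ 2 by rewrite sqrtr_sqr ger0_norm.
  by lra.
exists (- acos a); rewrite /expi cosN sinN acosK ?in_itv//= sa.
suff -> : 1 - a ^+ 2 = b ^+ 2 by rewrite sqrtr_sqr ltr0_norm// opprK.
by lra.
Qed.

Lemma normr_sin_le x : `|sin x| <= `|x|.
Proof.
wlog x0 : x / 0 <= x.
  move=> H; have [x0|x0] := leP 0 x; first exact: H.
  by rewrite -normrN -sinN -(normrN x) H// oppr_ge0 ltW.
have [c _ ] := MVT_segment x0 (fun c _ => is_derive_sin c)
  (continuous_subspaceT (@continuous_sin R)).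
rewrite sin0 !subr0 => ->; rewrite normrM ler_piMl//; exact: cos_max.
Qed.

Lemma cabs_expiB x y : cabs (expi x - expi y) <= `|x - y|.
Proof.
rewrite -(ler_sqr (cabs_ge0 _) (normr_ge0 _)) sqr_cabs real_normK ?num_real//.
rewrite ReD ImD ReN ImN /=.
have c : cos (x - y) = 1 - sin ((x - y) / 2) ^+ 2 *+ 2.
  rewrite -{1}(divfK (_ : 2 != 0) (x - y))//.
  by rewrite mulr_natr cos_mulr2n cos2sin2 !mulr2n; ring.
have h := normr_sin_le ((x - y) / 2).
have h2 : sin ((x - y) / 2) ^+ 2 <= ((x - y) / 2) ^+ 2.
  by rewrite -[leLHS]real_normK ?num_real// -[leRHS]real_normK ?num_real// ler_sqr// ?nnegrE.
have := cos2Dsin2 x; have := cos2Dsin2 y; move: c; rewrite cosB mulr2n; nra.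
Qed.

End ComplexModulus.

(** * Lipschitz maps of the plane *)

Section PlaneTopology.
Context {R : realType}.
Implicit Types (z w : R[i]) (A : set R[i]).

(** The norm that defines the topology of the plane takes complex values, so its
    balls have complex radii; this lemma and the next one pass to real radii. *)
Lemma within_nbhs_cabs A z (P : set R[i]) :
  (exists2 e : R, 0 < e & forall w, A w -> cabs (z - w) < e -> P w) ->
  within A (nbhs z) P.
Proof.
move=> [e e0 H]; apply/nbhs_ballP; exists e%:C; rewrite /= ?ltcR//.
move=> w; rewrite -ball_normE /= normc_cabs ltcR => zw Aw; exact: H.
Qed.

Lemma cvg_cabs T (F : set_system T) (f : T -> R[i]) z : Filter F ->
  (forall e : R, 0 < e -> \forall x \near F, cabs (z - f x) < e) ->
  f x @[x --> F] --> z.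
Proof.
move=> FF H; apply/cvgrPdist_lt => -[e i]; rewrite ltcE /= => /andP[/eqP i0 e0].
have := H e e0; apply: filterS => x zx.
by rewrite normc_cabs ltcE /= i0 eqxx.
Qed.

Lemma lipschitz_within_continuous A (L : R) (f : R[i] -> R[i]) :
  (forall z w, A z -> A w -> cabs (f z - f w) <= L * cabs (z - w)) ->
  {within A, continuous f}.
Proof.
move=> fL; apply/subspace_continuousP => z Az.
apply: cvg_cabs => e e0; apply: within_nbhs_cabs.
exists (e / (`|L| + 1)) => [|w Aw zw]; first by rewrite divr_gt0// ltr_wpDl.
apply: le_lt_trans (fL _ _ Az Aw) _.
rewrite ltr_pdivlMr ?ltr_wpDl// in zw.
have := cabs_ge0 (z - w); have := ler_norm L.
move: zw; set c := cabs _; nra.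
Qed.

End PlaneTopology.

(** * The circle maps $\theta\mapsto\theta+t\sin 2\theta$ *)

Section Lift.
Context {R : realType}.
Variable t : R.
Hypothesis t4 : `|t| < 1 / 4.
Implicit Types x y : R.

Definition lift x : R := x + t * sin (2 * x).

Lemma is_derive_lift x : is_derive x 1 lift (1 + 2 * t * cos (2 * x)).
Proof.
rewrite /lift; apply: is_derive_eq.
rewrite /GRing.scale /=; ring.
Qed.

Lemma continuous_lift : continuous lift.
Proof.
  by move=> x; apply: differentiable_continuous; apply/derivable1_diffP; case: (is_derive_lift x).
Qed.

Lemma lift_lip x y : x <= y ->
  (1 - 2 * `|t|) * (y - x) <= lift y - lift x <= (1 + 2 * `|t|) * (y - x).
Proof.
move=> xy; have : `|sin (2 * y) - sin (2 * x)| <= 2 * (y - x).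
  have := le_trans (normr_Im_le _) (cabs_expiB (2 * y) (2 * x)).
  by rewrite ImD ImN /= -mulrBr normrM normr_nat (@ger0_norm _ (y - x)) ?subr_ge0.
rewrite /lift; set s := sin (2 * y) - _ => hs.
have : `|t * s| <= `|t| * (2 * (y - x)) by rewrite normrM ler_wpM2l.
have -> : y + t * sin (2 * y) - (x + t * sin (2 * x)) = (y - x) + t * s.
  by rewrite /s; ring.
by rewrite ler_norml => /andP[h1 h2]; apply/andP; split; lra.
Qed.

Lemma lift_incr : {homo lift : x y / x < y}.
Proof.
move=> x y xy; have /andP[h _] := lift_lip (ltW xy).
rewrite -subr_gt0; apply: lt_le_trans h; rewrite mulr_gt0 ?subr_gt0//.
by have := t4; lra.
Qed.

Lemma lift_le : {mono lift : x y / x <= y}.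
Proof. exact/le_mono/lift_incr. Qed.

Lemma lift_inj : injective lift.
Proof. exact: inc_inj lift_le. Qed.

Lemma liftDpi x : lift (x + pi) = lift x + pi.
Proof. by rewrite /lift mulrDr (mulr_natl pi) sinD2pi addrAC. Qed.

Lemma liftD2pi x : lift (x + 2 * pi) = lift x + 2 * pi.
Proof. have -> : x + 2 * pi = (x + pi) + pi by ring.
by rewrite !liftDpi; ring. Qed.

Lemma lift_surj y : exists x, lift x = y.
Proof.
have [|||x _ <-] := @IVT _ lift (y - 1) (y + 1) y; last by exists x.
- by lra.
- exact/continuous_subspaceT/continuous_lift.
have b x : `|t * sin (2 * x)| <= 1 / 4.
  rewrite normrM; apply: le_trans (ltW t4); exact/ler_piMr/sin_max.
have := b (y - 1); have := b (y + 1); rewrite !ler_norml => /andP[h1 h2] /andP[h3 h4].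
rewrite /lift minEle maxEle; case: ifPn; [|rewrite -ltNge]; lra.
Qed.

Definition unlift y : R := projT1 (cid (lift_surj y)).

Lemma unliftK : cancel unlift lift.
Proof. by move=> y; rewrite /unlift; case: cid. Qed.

Lemma liftK : cancel lift unlift.
Proof. by move=> x; apply: lift_inj; rewrite unliftK. Qed.

Lemma is_derive_unlift y :
  is_derive y 1 unlift (1 + 2 * t * cos (2 * unlift y))^-1.
Proof.
have := @is_derive_inverse _ lift unlift _ (unlift y) _ _ (is_derive_lift _).
rewrite unliftK; apply.
- by near=> x; rewrite liftK.
- by near=> x; exact: continuous_lift.
- have := cos_max (2 * unlift y); set c := cos _ => c1.
  have : `|2 * t * c| <= 2 * `|t|.
    by rewrite !normrM ger0_norm// -mulrA ler_wpM2l// ler_piMr.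
  by move: t4; rewrite ler_norml => ? /andP[? ?]; apply: lt0r_neq0; lra.
Unshelve. all: by end_near. Qed.

Lemma lift_image a b : a <= b -> lift @` `[a, b] = `[lift a, lift b]%classic.
Proof.
move=> ab; apply/seteqP; split => [_ [x /= + <-]|y /=].
  by rewrite !in_itv /= => /andP[ax xb]; rewrite !lift_le ax xb.
rewrite in_itv /= => /andP[ay yb]; exists (unlift y); rewrite ?unliftK//=.
by rewrite in_itv /= -(lift_le a) -(lift_le _ b) unliftK ay yb.
Qed.

End Lift.

(** * Arc length *)

Section Arclength.
Local Notation arc := Defs.arc.
Context {R : realType}.
Implicit Types (a b x y : R) (k : int).

Lemma expi_inj2pi x y : 0 <= x -> x < 2 * pi -> 0 <= y -> y < 4 * pi ->
  expi x = expi y -> y = x \/ y = x + 2 * pi.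
Proof.
move=> x0 x2 y0 y4 /expi_inj[k xy].
have p0 := @twopi_gt0 R; have pp := @pi_gt0 R.
have k1 : (k < 1)%R.
  by rewrite -(ltr_int R) -(ltr_pM2r p0) mul1r; lra.
have k2 : (- 2 < k)%R.
  by rewrite -(ltr_int R) -(ltr_pM2r p0); lra.
have : (k == 0) || (k == -1) by lia.
case/orP => /eqP ek; rewrite ek in xy; [left|right]; lra.
Qed.

Lemma arc_shift a b k :
  arc a b = arc (a - k%:~R * (2 * pi)) (b - k%:~R * (2 * pi)).
Proof.
rewrite /arc; apply/seteqP; split => [_ [x /= + <-]|_ [x /= + <-]];
  rewrite in_itv /= => /andP[ax xb].
  exists (x - k%:~R * (2 * pi)); first by rewrite /= in_itv /= !lerB.
  by rewrite -mulNr -mulrNz expi_period.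
exists (x + k%:~R * (2 * pi)); last by rewrite expi_period.
by rewrite /= in_itv /=; apply/andP; split; lra.
Qed.

Lemma arclength_arc a b : a <= b -> b <= a + 2 * pi ->
  arclength (arc a b) = b - a.
Proof.
have p0 := @twopi_gt0 R; have pp := @pi_gt0 R.
wlog /andP[a0 a2] : a b / 0 <= a < 2 * pi.
  move=> H ab ba; have [k hk] := mod2pi a.
  by rewrite (arc_shift _ _ k) H//; lra.
move=> ab ba; rewrite /arclength.
have inE x : (`[0, 2 * pi[ `&` expi @^-1` arc a b : set R) x <->
    0 <= x < 2 * pi /\ (a <= x <= b \/ x + 2 * pi <= b).
  split => [[/= + [y /= +]]|[/andP[x0 x2] H]].
    rewrite !in_itv /= => /andP[x0 x2] /andP[ay yb] /esym exy.
    split; first exact/andP.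
    have [||<-|e] := expi_inj2pi x0 x2 _ _ exy; [lra|lra| |right; lra].
    by left; exact/andP.
  split; first by rewrite /= in_itv /= x0 x2.
  case: H => [/andP[ax xb]|xb].
    by exists x => //=; rewrite in_itv /= ax xb.
  exists (x + 2 * pi); last exact: expiD2pi.
  by rewrite /= in_itv /=; apply/andP; split; lra.
have [b2|b2] := ltP b (2 * pi).
  have -> : (`[0, 2 * pi[ `&` expi @^-1` arc a b : set R) = `[a, b]%classic.
    apply/seteqP; split => x; rewrite inE /= in_itv /=.
      by move=> [/andP[? ?] [//|]]; lra.
    by move=> /andP[? ?]; split; [apply/andP; split; lra|left; apply/andP].
  rewrite lebesgue_measure_itv /= lte_fin.
  by case: ltP => // ba'; rewrite /= (@le_anti _ _ a b) ?ab// subrr.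
have -> : (`[0, 2 * pi[ `&` expi @^-1` arc a b : set R) =
    `[0, 2 * pi[%classic `\` `]b - 2 * pi, a[%classic.
  apply/seteqP; split => x; rewrite inE /= !in_itv /=.
    move=> [/andP[x0 x2] H]; split; first exact/andP.
    by move=> /andP[? ?]; case: H => [/andP[? ?]|?]; lra.
  move=> [/andP[x0 x2] /negP]; rewrite negb_and -!leNgt => /orP[?|?].
    by split; [exact/andP|right; lra].
  by split; [exact/andP|left; apply/andP; split; lra].
rewrite measureD//=; last first.
  by rewrite lebesgue_measure_itv /= lte_fin p0 ltry.
rewrite [X in (_ - lebesgue_measure X)%E](_ : _ = `]b - 2 * pi, a[%classic).
  rewrite !lebesgue_measure_itv /= !lte_fin p0.
  case: ltP => ba' /=; first by ring.
  by rewrite ?oppr0 ?addr0; lra.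
apply/seteqP; split => x /=; rewrite !in_itv /=; first by case.
by move=> /andP[? ?]; split; [apply/andP; split; lra|apply/andP].
Qed.

End Arclength.

Section CircleMap.
Local Notation arc := Defs.arc.
Context {R : realType}.
Variables (t : R) (h : R[i] -> R[i]).
Hypothesis t4 : `|t| < 1 / 4.
Hypothesis hE : forall x, h (expi x) = expi (lift t x).
Implicit Types (z w : R[i]) (x : R).

(** On the circle the map is $h(z)=z\,e^{its(z)}$ where $s(z)=\mathrm{Im}\,z^2$
    is 2-Lipschitz for the chordal distance; the twist therefore changes chords
    by a factor between $1-2|t|$ and $1+2|t|$. *)
Lemma circle_map_chord z w : S1 z -> S1 w ->
  (1 - 2 * `|t|) * cabs (z - w) <= cabs (h z - h w)
    <= (1 + 2 * `|t|) * cabs (z - w).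
Proof.
move=> /expi_surj[x ->] /expi_surj[y ->]; rewrite !hE /lift !expiD.
set a := expi (t * _); set b := expi (t * sin (2 * y)).
have hs : `|sin (2 * x) - sin (2 * y)| <= 2 * cabs (expi x - expi y).
  have e u : sin (2 * u) = complex.Im (expi u * expi u).
    by rewrite -expiD mulr2n mulrDl mul1r.
  rewrite !e -ImN -ImD; apply: le_trans (normr_Im_le _) _.
  have -> : expi x * expi x - expi y * expi y =
    (expi x + expi y) * (expi x - expi y) by ring.
  rewrite cabsM ler_wpM2r ?cabs_ge0//.
  by apply: le_trans (cabsD _ _) _; rewrite !cabs_expi.
have hab : cabs (a - b) <= 2 * `|t| * cabs (expi x - expi y).
  apply: le_trans (cabs_expiB _ _) _; rewrite -mulrBr normrM.
  by rewrite [leRHS]mulrAC [leRHS]mulrC ler_wpM2l.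
have -> : expi x * a - expi y * b = (expi x - expi y) * a + expi y * (a - b).
  by ring.
have := cabsD ((expi x - expi y) * a) (expi y * (a - b)).
have := cabs_dist ((expi x - expi y) * a) (- (expi y * (a - b))).
rewrite opprK cabsN !cabsM !cabs_expi mul1r mulr1.
by move=> h1 h2; apply/andP; split; lra.
Qed.

Lemma circle_map_bij : set_bij S1 S1 h.
Proof.
split.
- by move=> _ /expi_surj[x ->]; rewrite /= hE; exact: S1_expi.
- move=> z w; rewrite !inE => z1 w1 hzw.
  have /andP[+ _] := circle_map_chord z1 w1.
  rewrite hzw subrr cabs0 pmulr_rle0; last by have := t4; lra.
  by move=> h0; apply/eqP; rewrite -subr_eq0 -cabs_eq0 eq_le h0 cabs_ge0.
- move=> _ /expi_surj[x ->]; exists (expi (unlift t4 x)); first exact: S1_expi.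
  by rewrite hE unliftK.
Qed.

Lemma circle_map_S1 z : S1 z -> S1 (h z).
Proof. by case: circle_map_bij => + _ _; apply. Qed.

Lemma circle_mapK z : S1 z -> pinv S1 h (h z) = z.
Proof.
by case: circle_map_bij => _ hi _ z1; apply: pinvKV => //; rewrite inE.
Qed.

Lemma circle_map_pinvK z : S1 z -> h (pinv S1 h z) = z.
Proof. by case: circle_map_bij => _ _ hs z1; rewrite (surjpK _ hs)// inE. Qed.

Lemma circle_map_pinv_S1 z : S1 z -> S1 (pinv S1 h z).
Proof. by have [H _ _] := bijpinv_bij (fun=> point) circle_map_bij => /H. Qed.

Lemma circle_map_pinv_expi x : pinv S1 h (expi x) = expi (unlift t4 x).
Proof. by rewrite -{1}(unliftK t4 x) -hE circle_mapK//; exact: S1_expi. Qed.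

Lemma circle_map_pinv_lip z w : S1 z -> S1 w ->
  cabs (pinv S1 h z - pinv S1 h w) <= 2 * cabs (z - w).
Proof.
move=> z1 w1.
have /andP[+ _] :=
  circle_map_chord (circle_map_pinv_S1 z1) (circle_map_pinv_S1 w1).
rewrite !circle_map_pinvK//; have := cabs_ge0 (pinv S1 h z - pinv S1 h w).
have := t4; nra.
Qed.

Lemma circle_map_lip z w : S1 z -> S1 w -> cabs (h z - h w) <= 2 * cabs (z - w).
Proof.
move=> z1 w1; have /andP[_] := circle_map_chord z1 w1.
have := cabs_ge0 (z - w); have := t4; nra.
Qed.

Lemma circle_map_homeo : homeomorphism S1 S1 h.
Proof.
split; first exact: circle_map_bij.
  exact: lipschitz_within_continuous circle_map_lip.
exact: lipschitz_within_continuous circle_map_pinv_lip.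
Qed.

Lemma circle_map_arc (a b : R) : a <= b -> h @` arc a b = arc (lift t a) (lift t b).
Proof.
move=> ab; rewrite /arc -(lift_image t4 ab).
apply/seteqP; split => [_ [_ [x abx <-] <-]|_ [_ [x abx <-] <-]].
  by exists (lift t x); [exists x|rewrite hE].
by exists (expi x); [exists x|rewrite hE].
Qed.

(** The lift changes lengths by a factor in $[1/2,3/2]$, whence the
    quasisymmetry constant 3. *)
Lemma circle_map_quasisymmetric : quasisymmetric h.
Proof.
split; first exact: circle_map_homeo.
  exists (lift t); split => //; last exact: lift_incr.
  exact: continuous_lift.
exists 3 => [|_ _ [a [b [c [ab bc ca -> ->]]]]]; first by rewrite ler1n.
have ab' := ltW ab; have bc' := ltW bc.
rewrite !circle_map_arc// !arclength_arc//; try by lra.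
- move=> eabc.
  have /andP[h1 h2] := lift_lip t ab'; have /andP[h3 h4] := lift_lip t bc'.
  have t0 := normr_ge0 t; have t4' := t4.
  have p : 0 < lift t c - lift t b by rewrite subr_gt0 lift_incr.
  rewrite ler_pdivrMr// ler_pdivlMr//; move: h1 h2 h3 h4; rewrite eabc.
  have : `|t| * (c - b) <= 1 / 4 * (c - b).
    by rewrite ler_wpM2r ?subr_ge0// ltW.
  by move=> *; apply/andP; split; lra.
- by rewrite lift_le.
- rewrite -liftD2pi lift_le//; lra.
- by rewrite lift_le.
- rewrite -liftD2pi lift_le//; lra.
Qed.

Lemma circle_map_normalized : normalized h.
Proof.
have eI : 'i = expi (pi / 2) :> R[i] by rewrite /expi cos_pihalf sin_pihalf.
split.
- by rewrite -{1}expi0 hE /lift !(mulr0, sin0, addr0) expi0.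
- by rewrite {1}eI hE /lift [2 * _]mulrC divfK// sinpi mulr0 addr0 -eI.
- by rewrite -{1}expipi hE /lift mulr_natl sin2pi mulr0 addr0 expipi.
Qed.

End CircleMap.

(** * Radial extensions *)

Section Radial.
Context {R : realType}.
Implicit Types (g k : R[i] -> R[i]) (z w : R[i]).

Definition radial g z := (cabs z)%:C * g (z / (cabs z)%:C).

Lemma radial_dir_S1 z : z != 0 -> S1 (z / (cabs z)%:C).
Proof.
move=> z0; rewrite /S1 /= cabsM cabsV cabs_real ger0_norm ?cabs_ge0//.
by rewrite divff// cabs_eq0.
Qed.

Lemma radial0 g : radial g 0 = 0.
Proof. by rewrite /radial cabs0 mul0r. Qed.

Lemma radial_S1 g z : S1 z -> radial g z = g z.
Proof. by rewrite /S1 /radial /= => ->; rewrite divr1 mul1r. Qed.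

Lemma cabs_radial g z : (forall w, S1 w -> S1 (g w)) ->
  cabs (radial g z) = cabs z.
Proof.
move=> gS; have [->|z0] := eqVneq z 0; first by rewrite radial0.
rewrite cabsM cabs_real ger0_norm ?cabs_ge0//.
by have /= := gS _ (radial_dir_S1 z0); rewrite /S1 /= => ->; rewrite mulr1.
Qed.

Lemma radialK g k z : (forall w, S1 w -> S1 (g w)) ->
  (forall w, S1 w -> k (g w) = w) -> radial k (radial g z) = z.
Proof.
move=> gS gK; have [->|z0] := eqVneq z 0; first by rewrite !radial0.
have c0 : (cabs z)%:C != 0 by rewrite eq_complex /= eqxx andbT cabs_eq0.
rewrite {1}/radial cabs_radial//.
rewrite /radial [(cabs z)%:C * g _ ]mulrC mulfK// gK; last exact: radial_dir_S1.
by rewrite mulrC divfK.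
Qed.

(** Radial and angular parts of a displacement are both at most the displacement,
    up to a factor 2 for the angular one. *)
Lemma radial_lip g (L : R) : 0 <= L -> (forall w, S1 w -> S1 (g w)) ->
  (forall z w, S1 z -> S1 w -> cabs (g z - g w) <= L * cabs (z - w)) ->
  forall z w, cabs (radial g z - radial g w) <= (1 + 2 * L) * cabs (z - w).
Proof.
move=> L0 gS gL z w.
have H x : cabs x <= (1 + 2 * L) * cabs x by have := cabs_ge0 x; nra.
have [->|z0] := eqVneq z 0; first by rewrite radial0 !sub0r !cabsN cabs_radial.
have [->|w0] := eqVneq w 0; first by rewrite radial0 !subr0 cabs_radial.
have cz0 : (cabs z)%:C != 0 by rewrite eq_complex /= eqxx andbT cabs_eq0.
have cw0 : (cabs w)%:C != 0 by rewrite eq_complex /= eqxx andbT cabs_eq0.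
have uS := radial_dir_S1 z0; have vS := radial_dir_S1 w0.
rewrite /radial; set u := z / _ in uS *; set v := w / _ in vS *.
have zu : z = (cabs z)%:C * u by rewrite mulrC divfK.
have wv : w = (cabs w)%:C * v by rewrite mulrC divfK.
have d : `|cabs z - cabs w| <= cabs (z - w).
  rewrite ler_norml cabs_dist andbT.
  by have := cabs_dist w z; rewrite cabsBC; lra.
have guv := gL u v uS vS.
have suv : cabs w * cabs (u - v) <= 2 * cabs (z - w).
  rewrite -{1}(ger0_norm (cabs_ge0 w)) -cabs_real -cabsM mulrBr -wv.
  have -> : (cabs w)%:C * u - w = (cabs w - cabs z)%:C * u + (z - w).
    by rewrite rmorphB /= mulrBl -zu; ring.
  apply: le_trans (cabsD _ _) _.
  rewrite cabsM uS mulr1 cabs_real distrC; lra.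
have -> : (cabs z)%:C * g u - (cabs w)%:C * g v =
    (cabs z - cabs w)%:C * g u + (cabs w)%:C * (g u - g v).
  by rewrite rmorphB /=; ring.
apply: le_trans (cabsD _ _) _.
have guS : cabs (g u) = 1 := gS _ uS.
rewrite !cabsM guS mulr1 !cabs_real (ger0_norm (cabs_ge0 w)).
have : cabs w * cabs (g u - g v) <= L * (2 * cabs (z - w)).
  apply: le_trans (ler_wpM2l (cabs_ge0 w) guv) _.
  by rewrite mulrCA ler_wpM2l.
lra.
Qed.

Lemma radial_homeomorphism g k (L : R) : 0 <= L ->
  (forall w, S1 w -> S1 (g w)) -> (forall w, S1 w -> S1 (k w)) ->
  (forall w, S1 w -> k (g w) = w) -> (forall w, S1 w -> g (k w) = w) ->
  (forall z w, S1 z -> S1 w -> cabs (g z - g w) <= L * cabs (z - w)) ->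
  (forall z w, S1 z -> S1 w -> cabs (k z - k w) <= L * cabs (z - w)) ->
  homeomorphism disk disk (radial g).
Proof.
move=> L0 gS kS gK kK gL kL.
have bij : set_bij disk disk (radial g).
  split.
  - by move=> z /=; rewrite /disk /= cabs_radial.
  - move=> z w _ _ /(congr1 (radial k)).
    by rewrite !(radialK _ gS gK).
  - move=> z zD; exists (radial k z); rewrite /disk /= ?cabs_radial//.
    exact: radialK.
split; first exact: bij.
  apply: (@lipschitz_within_continuous _ _ (1 + 2 * L)) => z w _ _.
  exact: (radial_lip L0 gS gL).
apply: (@lipschitz_within_continuous _ _ (1 + 2 * L)).
have E z : disk z -> pinv disk (radial g) z = radial k z.
  move=> zD; have [_ hi _] := bij.
  rewrite -{1}(radialK z kS kK) pinvKV// inE /disk /=.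
  by rewrite cabs_radial.
by move=> z w zD wD; rewrite !E//; exact: (radial_lip L0 kS kL).
Qed.

End Radial.

Section Lipschitz.
Context {R : realType}.
Implicit Types (F : R[i] -> R[i]) (L : R).

Lemma lipschitz_abs_continuous (a b L : R) (f : R -> R[i]) :
  (forall x y, cabs (f x - f y) <= L * `|x - y|) -> abs_continuous a b f.
Proof.
move=> fL e e0; exists (e / (`|L| + 1)); first by rewrite divr_gt0// ltr_wpDl.
move=> s sab _ sd.
have s0 : 0 <= \sum_(p <- s) (p.2 - p.1).
  rewrite big_seq sumr_ge0// => p ps; rewrite subr_ge0.
  by have /allP/(_ _ ps)/andP[/andP[]] := sab.
have : \sum_(p <- s) cabs (f p.2 - f p.1) <= L * \sum_(p <- s) (p.2 - p.1).
  rewrite mulr_sumr big_seq [leRHS]big_seq ler_sum// => p ps.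
  have /allP/(_ _ ps)/andP[/andP[_ p12] _] := sab.
  by apply: le_trans (fL _ _) _; rewrite ger0_norm// subr_ge0.
move=> /le_lt_trans; apply; rewrite ltr_pdivlMr ?ltr_wpDl// in sd.
have := ler_norm L; move: sd s0; set c := \sum_(p <- s) _; nra.
Qed.

Lemma lipschitz_ACL D F L :
  (forall z w, cabs (F z - F w) <= L * cabs (z - w)) -> ACL D F.
Proof.
move=> FL a b c d _ _ _; split; apply: aeW => /= x _;
  apply: (@lipschitz_abs_continuous _ _ L) => y y'; apply: le_trans (FL _ _) _.
  suff -> : y +i* x - y' +i* x = (y - y')%:C by rewrite cabs_real.
  by apply: complex_ext; rewrite ?ReD ?ReN ?ImD ?ImN /= ?subrr.
have -> : x +i* y - x +i* y' = 'i * (y - y')%:C.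
  apply: complex_ext; rewrite ?ReD ?ReN ?ImD ?ImN ?ReM ?ImM /=; ring.
rewrite cabsM cabs_real.
have -> : cabs ('i : R[i]) = 1 by rewrite /cabs /= expr0n expr1n add0r sqrtr1.
by rewrite mul1r.
Qed.

Lemma lipschitz_boundary_values F g L :
  (forall z w, cabs (F z - F w) <= L * cabs (z - w)) ->
  (forall w, S1 w -> F w = g w) -> boundary_values F g.
Proof.
move=> FL Fg w w1; rewrite -(Fg _ w1).
apply: cvg_cabs => e e0; apply: within_nbhs_cabs.
exists (e / (`|L| + 1)) => [|z Dz zw]; first by rewrite divr_gt0// ltr_wpDl.
apply: le_lt_trans (FL _ _) _.
rewrite ltr_pdivlMr ?ltr_wpDl// in zw.
have := cabs_ge0 (w - z); have := ler_norm L.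
move: zw; set c := cabs _; nra.
Qed.

End Lipschitz.

(** * Beltrami coefficient of the radial extension *)

Section RadialBeltrami.
Context {R : realType}.
Variables (t : R) (h : R[i] -> R[i]).
Hypothesis t4 : `|t| < 1 / 4.
Hypothesis hE : forall x, h (expi x) = expi (lift t x).
Implicit Types (x y w : R).

Local Notation psi w := (unlift t4 (atan w)).
Local Notation dpsi w := (1 + 2 * t * cos (2 * psi w))^-1.
Local Notation rho w := (Num.sqrt (1 + w ^+ 2)).

Lemma unliftDpi y : unlift t4 (y + pi) = unlift t4 y + pi.
Proof. by apply: (lift_inj t4); rewrite liftDpi !unliftK. Qed.

Lemma rho_gt0 w : 0 < rho w.
Proof. by rewrite sqrtr_gt0 ltr_pwDl// sqr_ge0. Qed.

Lemma polar_atan w : 1 +i* w = (rho w)%:C * expi (atan w).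
Proof.
have r0 := lt0r_neq0 (rho_gt0 w).
have c : cos (atan w) = (rho w)^-1 by rewrite cos_atan.
have s : sin (atan w) = w / rho w.
  have := atanK w; rewrite /tan c invrK => e.
  by rewrite -{2}e mulfK.
by apply: complex_ext; rewrite ?ReM ?ImM /= c s; field.
Qed.

(** The symmetry $h(-z)=-h(z)$ makes the extension odd, so that the same formula
    serves both half-planes. *)
Lemma radial_homogeneous x y : x != 0 ->
  radial (pinv S1 h) (x +i* y) =
  x%:C * ((rho (y / x))%:C * expi (psi (y / x))).
Proof.
move=> x0; set w := y / x.
have zE : x +i* y = x%:C * ((rho w)%:C * expi (atan w)).
  by rewrite -polar_atan; apply: complex_ext; rewrite ?ReM ?ImM /= /w; field.
have r0 := rho_gt0 w.
have rC : (rho w)%:C != 0 by rewrite eq_complex /= eqxx andbT lt0r_neq0.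
have cE : cabs (x +i* y) = `|x| * rho w.
  by rewrite zE !cabsM !cabs_real cabs_expi mulr1 (gtr0_norm r0).
rewrite /radial cE zE.
have [xn|xp|xx] := ltgtP x 0; last by rewrite xx eqxx in x0.
- rewrite ltr0_norm// mulNr rmorphN rmorphM /= .
  have -> : x%:C * ((rho w)%:C * expi (atan w)) / - (x%:C * (rho w)%:C) =
      expi (atan w + pi).
    rewrite expiD expipi; field.
    by rewrite rC eq_complex /= eqxx andbT x0.
  rewrite (circle_map_pinv_expi t4 hE) unliftDpi expiD expipi; ring.
- rewrite gtr0_norm// rmorphM /= .
  have -> : x%:C * ((rho w)%:C * expi (atan w)) / (x%:C * (rho w)%:C) =
      expi (atan w).
    by field; rewrite rC eq_complex /= eqxx andbT x0.
  by rewrite (circle_map_pinv_expi t4 hE) mulrA.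
Qed.

Lemma is_derive_rho w : is_derive w 1 (fun v : R => rho v) (w / rho w).
Proof.
have h1 : is_derive w 1 (fun v : R => 1 + v ^+ 2) (2 * w).
  by apply: is_derive_eq; rewrite /GRing.scale /=; ring.
have h2 := @is_derive1_sqrt R (1 + w ^+ 2) (ltr_pwDl ltr01 (sqr_ge0 w)).
have := @is_derive1_comp R _ _ w _ _ h2 h1.
move=> h3; apply: (is_derive_eq h3).
by have := lt0r_neq0 (rho_gt0 w); move=> ?; field.
Qed.

Lemma is_derive_psi w : is_derive w 1 (fun v : R => psi v) (dpsi w / (1 + w ^+ 2)).
Proof.
exact: (@is_derive1_comp R _ _ w _ _ (is_derive_unlift t4 _) (is_derive1_atan w)).
Qed.

Definition profile_re w := rho w * cos (psi w).
Definition profile_im w := rho w * sin (psi w).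

Lemma is_derive_profile_re w : is_derive w 1 profile_re
  ((w * cos (psi w) - dpsi w * sin (psi w)) / rho w).
Proof.
have h1 := is_derive_rho w; have h2 := is_derive_psi w.
have h3 := @is_derive1_comp R _ _ w _ _ (is_derive_cos (psi w)) h2.
have h4 := @is_deriveM R _ _ _ w 1 _ _ h1 h3.
apply: (is_derive_eq h4).
have r0 := rho_gt0 w.
have r2 : 1 + w ^+ 2 = rho w ^+ 2 by rewrite sqr_sqrtr// addr_ge0// sqr_ge0.
move: r0 r2; rewrite /GRing.scale /=.
set d := dpsi w; set r := rho w; set c := cos _; set s := sin _ => r0 ->.
by field; exact: lt0r_neq0.
Qed.

Lemma is_derive_profile_im w : is_derive w 1 profile_im
  ((w * sin (psi w) + dpsi w * cos (psi w)) / rho w).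
Proof.
have h1 := is_derive_rho w; have h2 := is_derive_psi w.
have h3 := @is_derive1_comp R _ _ w _ _ (is_derive_sin (psi w)) h2.
have h4 := @is_deriveM R _ _ _ w 1 _ _ h1 h3.
apply: (is_derive_eq h4).
have r0 := rho_gt0 w.
have r2 : 1 + w ^+ 2 = rho w ^+ 2 by rewrite sqr_sqrtr// addr_ge0// sqr_ge0.
move: r0 r2; rewrite /GRing.scale /=.
set d := dpsi w; set r := rho w; set c := cos _; set s := sin _ => r0 ->.
by field; exact: lt0r_neq0.
Qed.

End RadialBeltrami.

Section RadialDilatation.
Context {R : realType}.
Variables (t : R) (h : R[i] -> R[i]).
Hypothesis t4 : `|t| < 1 / 4.
Hypothesis hE : forall x, h (expi x) = expi (lift t x).
Implicit Types (x y w : R).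

Local Notation psi w := (unlift t4 (atan w)).
Local Notation dpsi w := (1 + 2 * t * cos (2 * psi w))^-1.
Local Notation rho w := (Num.sqrt (1 + w ^+ 2)).
Local Notation F := (radial (pinv S1 h)).

Lemma radial_Re x y : x != 0 ->
  complex.Re (F (x +i* y)) = x * profile_re t4 (y / x).
Proof.
move=> x0; rewrite (radial_homogeneous t4 hE)//.
by rewrite !ReM !ImM /= /profile_re; ring.
Qed.

Lemma radial_Im x y : x != 0 ->
  complex.Im (F (x +i* y)) = x * profile_im t4 (y / x).
Proof.
move=> x0; rewrite (radial_homogeneous t4 hE)//.
by rewrite !ImM ?ReM /= /profile_im; ring.
Qed.

Lemma derive1_homogeneous_x (G : R -> R -> R) (P : R -> R) dP x y : x != 0 ->
  (forall x', x' != 0 -> G x' y = x' * P (y / x')) ->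
  is_derive (y / x) 1 P dP ->
  derive1 (fun x' => G x' y) x = P (y / x) - y / x * dP.
Proof.
move=> x0 GP dPw; rewrite derive1E; apply: derive_val.
apply: (@near_eq_is_derive _ _ _ (fun x' => x' * P (y / x'))).
  near=> x'; rewrite GP//.
  by near: x'; exists `|x| => /=; rewrite ?normr_gt0// => x' /=; apply: contraTneq => ->; rewrite subr0 ltxx.
have h1 : is_derive x 1 (fun x' => y / x') (- y / x ^+ 2).
  have h0 := is_deriveV x0 (is_derive_id x 1).
  have := @is_deriveM R _ (cst y) _ x 1 _ _ (is_derive_cst y x 1) h0.
  by move=> h2; apply: (is_derive_eq h2); rewrite /GRing.scale /= ; field.
have h2 := @is_derive1_comp R _ _ x _ _ dPw h1.
have h3 := @is_deriveM R _ _ _ x 1 _ _ (is_derive_id x 1) h2.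
by apply: (is_derive_eq h3); rewrite /GRing.scale /=; field.
Unshelve. all: by end_near. Qed.

Lemma derive1_homogeneous_y (G : R -> R -> R) (P : R -> R) dP x y : x != 0 ->
  (forall y', G x y' = x * P (y' / x)) ->
  is_derive (y / x) 1 P dP ->
  derive1 (fun y' => G x y') y = dP.
Proof.
move=> x0 GP dPw.
rewrite (_ : (fun y' => G x y') = (fun y' => x * P (y' / x))); last exact/funext.
rewrite derive1E; apply: derive_val.
have h1 : is_derive y 1 (fun y' => y' / x) x^-1.
  have := @is_deriveM R _ id (cst x^-1) y 1 _ _ (is_derive_id y 1) (is_derive_cst x^-1 y 1).
  by move=> h2; apply: (is_derive_eq h2); rewrite /GRing.scale /= ; field.
have h2 := @is_derive1_comp R _ _ y _ _ dPw h1.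
have h3 := @is_deriveM R _ (cst x) _ y 1 _ _ (is_derive_cst x y 1) h2.
by apply: (is_derive_eq h3); rewrite /GRing.scale /=; field.
Qed.

(** In the coordinate $\log z$ the extension is $s+i\theta\mapsto
    s+i\psi(\theta)$, so that both Wirtinger derivatives are governed by
    $\psi'$ alone. *)
Lemma radial_wirtinger x y : x != 0 ->
  cabs (dzbar F (x +i* y)) = `|1 - dpsi (y / x)| / 2 /\
  cabs (dz F (x +i* y)) = `|1 + dpsi (y / x)| / 2.
Proof.
move=> x0.
have px : partial_x F (x +i* y) = _ +i* _ := congr2 (@Complex R)
  (derive1_homogeneous_x (G := fun x y => complex.Re (F (x +i* y))) x0
    (fun x' => @radial_Re x' y) (is_derive_profile_re t4 _))
  (derive1_homogeneous_x (G := fun x y => complex.Im (F (x +i* y))) x0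
    (fun x' => @radial_Im x' y) (is_derive_profile_im t4 _)).
have py : partial_y F (x +i* y) = _ +i* _ := congr2 (@Complex R)
  (derive1_homogeneous_y (G := fun x y => complex.Re (F (x +i* y))) x0
    (fun y' => @radial_Re x y' x0) (is_derive_profile_re t4 _))
  (derive1_homogeneous_y (G := fun x y => complex.Im (F (x +i* y))) x0
    (fun y' => @radial_Im x y' x0) (is_derive_profile_im t4 _)).
set w := y / x in px py *.
have r0 := rho_gt0 w.
have r2 : rho w ^+ 2 = 1 + w ^+ 2 by rewrite sqr_sqrtr// addr_ge0// sqr_ge0.
rewrite /dzbar /dz px py /profile_re /profile_im.
have cw u : u = w \/ u = - w -> cabs (1 +i* u) = rho w.
  by rewrite /cabs /= expr1n => -[->|->]; rewrite ?sqrrN.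
have c2 : cabs (2 : R[i]) = 2.
  by rewrite -[2](rmorph_nat (real_complex R)) cabs_real normr_nat.
move: r0 r2 cw; set r := rho w; set d := dpsi w => r0 r2 cw.
have r1 := lt0r_neq0 r0.
have cabs_prod e v : v = w \/ v = - w ->
    cabs ((e / r)%:C * expi (psi w) * (1 +i* v) / 2) = `|e| / 2.
  move=> hv; rewrite !cabsM cabsV c2 cabs_expi cabs_real cw// mulr1.
  by rewrite normrM normfV (gtr0_norm r0) divfK.
have w2 : w ^+ 2 = r ^+ 2 - 1 by rewrite r2; ring.
split.
- rewrite -(cabs_prod (1 - d) w); last by left.
  congr (cabs (_ / 2)); apply: complex_ext;
    rewrite !(ReD, ImD, ReM, ImM) /=; set c := cos _; set s := sin _;
    field: w2; exact: r1.
- rewrite -(cabs_prod (1 + d) (- w)); last by right.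
  congr (cabs (_ / 2)); apply: complex_ext;
    rewrite !(ReD, ImD, ReN, ImN, ReM, ImM) /=; set c := cos _; set s := sin _;
    field: w2; exact: r1.
Qed.

End RadialDilatation.

(** * Teichmueller distance *)

Section BeltramiNorm.
Context {R : realType}.
Implicit Type F : R[i] -> R[i].

Lemma ae_plane_measure_fst_neq0 (P : R * R -> Prop) :
  (forall p : R * R, p.1 != 0 -> P p) -> {ae plane_measure, forall p, P p}.
Proof.
move=> H.
exists ([set 0] `*` setT); split.
- exact: measurableX.
- have -> : plane_measure ([set 0] `*` setT) =
      (lebesgue_measure [set 0%R : R] * lebesgue_measure [set: R])%E.
    exact: product_measure1E.
  by rewrite lebesgue_measure_set1 mul0e.
- move=> p /= nP; split => //=.
  by apply: contrapT => /eqP/H.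
Qed.

Lemma plane_measure_gt0 : (0 < @plane_measure R setT)%E.
Proof.
rewrite -setXTT.
have -> : plane_measure (setT `*` setT) =
    (lebesgue_measure [set: R] * lebesgue_measure [set: R])%E.
  exact: product_measure1E.
have -> : (setT : set R) = [set` `]-oo, +oo[] by rewrite set_itvE.
by rewrite lebesgue_measure_itv /= mulyy.
Qed.

Lemma beltrami_norm_bounds F (k : R) :
  {ae plane_measure, forall p : R * R,
    cabs (beltrami F (p.1 +i* p.2)) * \1_disk (p.1 +i* p.2) <= k} ->
  0 <= beltrami_norm F <= k.
Proof.
move=> Fk; rewrite /beltrami_norm.
set u := (fun p : R * R => _).
have u0 : (0 <= ess_sup plane_measure u)%E.
  apply: ess_sup_gee; first exact: plane_measure_gt0.
  by apply: aeW => p; rewrite /u lee_fin mulr_ge0 ?cabs_ge0.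
have uk : (ess_sup plane_measure u <= k%:E)%E.
  by apply/ess_supP; apply: (@filterS _ _ (ae_filter_ringOfSetsType plane_measure)) Fk => p; rewrite /u lee_fin.
have ufin : ess_sup plane_measure u \is a fin_num.
  by rewrite ge0_fin_numE// (le_lt_trans uk) ?ltry.
by rewrite fine_ge0//= -lee_fin fineK.
Qed.

Lemma quasiconformal_dilatation_ge1 F : quasiconformal F -> 1 <= dilatation F.
Proof.
move=> [_ _ [k /andP[k0 k1] Fk]].
have /andP[b0 bk] : 0 <= beltrami_norm F <= k.
  apply: beltrami_norm_bounds; apply: (@filterS _ _ (ae_filter_ringOfSetsType plane_measure)) Fk => p Hp.
  have [Dp|nDp] := pselect (disk (p.1 +i* p.2)); last first.
    by rewrite indicE memNset//= mulr0.
  rewrite indicE mem_set//= mulr1 /beltrami cabsM cabsV.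
  have [->|d0] := eqVneq (cabs (dz F (p.1 +i* p.2))) 0; first by rewrite invr0 mulr0.
  by rewrite ler_pdivrMr ?lt0r ?d0 ?cabs_ge0//; exact: Hp.
rewrite /dilatation ler_pdivlMr; lra.
Qed.

End BeltramiNorm.

Section TeichmullerDistance.
Context {R : realType}.
Variables (t : R) (h : R[i] -> R[i]).
Hypothesis t4 : `|t| < 1 / 4.
Hypothesis hE : forall x, h (expi x) = expi (lift t x).
Local Notation F := (radial (pinv S1 h)).

Lemma radial_beltrami_bound (x y : R) : x != 0 ->
  cabs (dzbar F (x +i* y)) <= 2 * `|t| * cabs (dz F (x +i* y)) /\
  cabs (dz F (x +i* y)) != 0.
Proof.
move=> x0; have [-> ->] := radial_wirtinger t4 hE y x0.
set c := cos _.
have c1 : `|c| <= 1 by exact: cos_max.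
have tc : `|2 * t * c| <= 2 * `|t|.
  by rewrite !normrM normr_nat ler_piMr// mulr_ge0.
have t4' := t4; have t0 := normr_ge0 t.
move: tc; set e := 2 * t * c => tc.
have /andP[e1 e2] : - (1 / 2) < e < 1 / 2 by rewrite -ltr_norml; lra.
have e0 : 1 + e != 0 by apply: lt0r_neq0; lra.
have p0 : 0 < (1 + e)^-1 by rewrite invr_gt0; lra.
have -> : 1 - (1 + e)^-1 = e * (1 + e)^-1 by field.
have -> : 1 + (1 + e)^-1 = (2 + e) * (1 + e)^-1 by field.
rewrite !(normrM _ (1 + e)^-1) (gtr0_norm p0) (@ger0_norm _ (2 + e)); last lra.
split; last first.
  by rewrite !mulf_neq0// ?invr_eq0 ?(lt0r_neq0 p0)//; apply: lt0r_neq0; lra.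
have -> : 2 * `|t| * ((2 + e) * (1 + e)^-1 / 2) = (2 * `|t| * (2 + e)) * (1 + e)^-1 / 2.
  by rewrite !mulrA.
rewrite ler_pM2r ?invr_gt0// ler_pM2r//.
apply: le_trans tc _; rewrite ler_peMr ?mulr_ge0//; lra.
Qed.

Lemma radial_quasiconformal : quasiconformal F.
Proof.
have S := circle_map_pinv_S1 t4 hE.
have L := circle_map_pinv_lip t4 hE.
split.
- apply: (radial_homeomorphism (k := h) (L := 2)) => //.
  + exact: circle_map_S1 t4 hE.
  + exact: circle_map_pinvK t4 hE.
  + exact: circle_mapK t4 hE.
  + exact: circle_map_lip t4 hE.
- by apply: (@lipschitz_ACL _ _ _ (1 + 2 * 2)); apply: radial_lip S L.
- exists (2 * `|t|); first by have := t4; have := normr_ge0 t; lra.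
  by apply: ae_plane_measure_fst_neq0 => p p0 _; have [] := radial_beltrami_bound p.2 p0.
Qed.

Lemma radial_beltrami_norm : 0 <= beltrami_norm F <= 2 * `|t|.
Proof.
apply: beltrami_norm_bounds; apply: ae_plane_measure_fst_neq0 => -[x y] /= x0.
have [Fk d0] := radial_beltrami_bound y x0.
apply: (@le_trans _ _ (cabs (beltrami F (x +i* y)))).
  by rewrite ler_piMr ?cabs_ge0// indicE; case: (_ \in _).
by rewrite /beltrami cabsM cabsV ler_pdivrMr// lt0r d0 cabs_ge0.
Qed.

Lemma teichmuller_distance_bounds :
  (0 <= teichmuller_distance h id <= (4 * `|t|)%:E)%E.
Proof.
rewrite /teichmuller_distance; apply/andP; split.
  rewrite mule_ge0 ?lee_fin// le_ereal_inf_tmp// => _ [G [Gqc _] <-].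
  by rewrite lee_fin ln_ge0// quasiconformal_dilatation_ge1.
have /andP[b0 b1] := radial_beltrami_norm.
have t4' := t4; have t0 := normr_ge0 t.
have -> : (4 * `|t|)%:E = ((2^-1)%:E * (8 * `|t|)%:E)%E.
  by rewrite -EFinM; congr (_%:E); field.
rewrite lee_pmul2l ?lte_fin ?invr_gt0//.
apply: (@le_trans _ _ (ln (dilatation F))%:E).
  apply: ereal_inf_lbound; exists F => //; split; first exact: radial_quasiconformal.
  apply: lipschitz_boundary_values => [|w w1]; last by rewrite radial_S1.
  by apply: (radial_lip (L := 2)); [|exact: circle_map_pinv_S1 t4 hE|exact: circle_map_pinv_lip t4 hE].
rewrite lee_fin /dilatation; set b := beltrami_norm F in b0 b1 *.
have -> : (1 + b) / (1 - b) = 1 + 2 * b / (1 - b) by field; apply: lt0r_neq0; lra.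
have d0 : 0 < 1 - b by lra.
have : 2 * b / (1 - b) <= 4 * b by rewrite ler_pdivrMr//; nra.
have : 0 <= 2 * b / (1 - b) by rewrite divr_ge0 ?mulr_ge0// ltW.
move=> h1 h2; apply: le_trans (le_ln1Dx _) _; lra.
Qed.

End TeichmullerDistance.

Lemma teichmuller_distance_cvg0 (R : realType) (h : R -> R[i] -> R[i]) :
  (forall t x : R, `|t| < 1 / 4 -> h t (expi x) = expi (lift t x)) ->
  teichmuller_distance (h t) id @[t --> (0 : R)] --> (0%E : \bar R).
Proof.
move=> hE; apply: (@squeeze_cvge _ _ _ _ (cst 0%E) _ (fun t : R => (4 * `|t|)%:E)).
- have N : \forall t \near (0 : R), `|t| < 1 / 4 by apply: nbhs0_lt; rewrite divr_gt0.
  by apply: filterS N => t t4; apply: (teichmuller_distance_bounds t4) => x; exact: hE.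
- exact: cvg_cst.
- apply: cvg_EFin; first by near=> t.
  rewrite -[X in _ --> X](mulr0 4); apply: cvgM; first exact: cvg_cst.
  rewrite -[X in _ --> X](@normr0 R R); apply: cvg_norm; exact: cvg_id.
Unshelve. all: by end_near. Qed.

(** * Averages over a period *)

Section Continuity.
Context {R : realType}.
Implicit Types f g : R -> R.

Lemma cont_cst (c : R) : continuous (fun _ : R => c).
Proof. by move=> x; exact: cvg_cst. Qed.

Lemma cont_id : continuous (fun x : R => x).
Proof. by move=> x; exact: cvg_id. Qed.

Lemma cont_add f g : continuous f -> continuous g ->
  continuous (fun x => f x + g x).
Proof. by move=> cf cg x; apply: cvgD; [exact: cf|exact: cg]. Qed.

Lemma cont_opp f : continuous f -> continuous (fun x => - f x).
Proof. by move=> cf x; apply: cvgN; exact: cf. Qed.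

Lemma cont_mul f g : continuous f -> continuous g ->
  continuous (fun x => f x * g x).
Proof. by move=> cf cg x; apply: cvgM; [exact: cf|exact: cg]. Qed.

Lemma cont_exp f n : continuous f -> continuous (fun x => f x ^+ n).
Proof.
move=> cf; elim: n => [|n IH]; first exact: cont_cst.
by under eq_fun do rewrite exprS; exact: cont_mul.
Qed.

Lemma cont_sin f : continuous f -> continuous (fun x => sin (f x)).
Proof.
by move=> cf x; apply: continuous_comp; [exact: cf|exact: continuous_sin].
Qed.

Lemma cont_cos f : continuous f -> continuous (fun x => cos (f x)).
Proof.
by move=> cf x; apply: continuous_comp; [exact: cf|exact: continuous_cos].
Qed.

Lemma cont_sum (I : Type) (s : seq I) (F : I -> R -> R) :
  (forall i, continuous (F i)) -> continuous (fun x => \sum_(i <- s) F i x).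
Proof.
move=> cF; elim: s => [|i s IH].
  by under eq_fun do rewrite big_nil; exact: cont_cst.
by under eq_fun do rewrite big_cons; exact: cont_add.
Qed.

End Continuity.

Ltac continuity_step :=
  lazymatch goal with
  | |- continuous (fun _ => ?c) => exact (@cont_cst _ c)
  | |- continuous (fun x => x) => exact (@cont_id _)
  | |- continuous (fun x => @?f x + @?g x) => refine (@cont_add _ f g _ _)
  | |- continuous (fun x => - @?f x) => refine (@cont_opp _ f _)
  | |- continuous (fun x => @?f x * @?g x) => refine (@cont_mul _ f g _ _)
  | |- continuous (fun x => @?f x ^+ ?n) => refine (@cont_exp _ f n _)
  | |- continuous (fun x => sin (@?f x)) => refine (@cont_sin _ f _)
  | |- continuous (fun x => cos (@?f x)) => refine (@cont_cos _ f _)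
  | |- _ => assumption
  end; cbv beta.
Ltac continuity := repeat continuity_step.

Section Average.
Context {R : realType}.
Local Notation mu := (@lebesgue_measure R).
Local Notation period := (`[0, 2 * pi]%classic : set R).
Implicit Types (f g F : R -> R) (c : R).

Definition periodic_integrable f := mu.-integrable period (EFin \o f).

Definition avg f : R := (2 * pi)^-1 * Rintegral mu period f.

Lemma continuous_periodic_integrable f : continuous f -> periodic_integrable f.
Proof.
move=> cf; apply: continuous_compact_integrable; first exact: segment_compact.
exact: continuous_subspaceT.
Qed.

Lemma periodic_integrableD f g : periodic_integrable f ->
  periodic_integrable g -> periodic_integrable (fun x => f x + g x).
Proof.
rewrite /periodic_integrable => fi gi.
have mp : measurable period by exact: measurable_itv.
rewrite (_ : EFin \o _ = (EFin \o f) \+ (EFin \o g))%E//.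
exact: integrableD.
Qed.

Lemma periodic_integrableM f g : periodic_integrable f -> continuous g ->
  periodic_integrable (fun x => f x * g x).
Proof.
rewrite /periodic_integrable => fi cg; have mp : measurable period by exact: measurable_itv.
have mg : measurable_fun period g.
  by apply: measurable_funTS; exact: continuous_measurable_fun.
have bg : [bounded g x | x in period].
  have cgp : {within period, continuous g} by exact: continuous_subspaceT.
  have /compact_bounded[M [_ Mg]] :=
    continuous_compact cgp (@segment_compact R 0 (2 * pi)).
  by exists M; split; rewrite ?num_real// => r Mr x px; apply: (Mg _ Mr); exists x.
rewrite (_ : EFin \o _ = (EFin \o f) \* (EFin \o g))%E//.
exact: integrableMl.
Qed.

Lemma avg_ext f g : f =1 g -> avg f = avg g.
Proof. by move=> /funext ->. Qed.

Lemma avgD f g : periodic_integrable f -> periodic_integrable g ->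
  avg (fun x => f x + g x) = avg f + avg g.
Proof. by move=> fi gi; rewrite /avg RintegralD// mulrDr. Qed.

Lemma avgZ c f : periodic_integrable f -> avg (fun x => c * f x) = c * avg f.
Proof. by move=> fi; rewrite /avg RintegralZl// mulrCA. Qed.

Lemma avg_ge0 f : (forall x, 0 <= f x) -> 0 <= avg f.
Proof.
move=> f0; rewrite /avg mulr_ge0 ?invr_ge0 ?(ltW twopi_gt0)//.
by apply: Rintegral_ge0 => x _.
Qed.

Lemma le_avg f g : periodic_integrable f -> periodic_integrable g ->
  (forall x, f x <= g x) -> avg f <= avg g.
Proof.
move=> fi gi fg; rewrite /avg ler_pM2l ?invr_gt0 ?twopi_gt0//.
by apply: le_Rintegral.
Qed.

Lemma avg_cst c : avg (fun _ => c) = c.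
Proof.
rewrite /avg Rintegral_cst//= lebesgue_measure_itv /= lte_fin twopi_gt0 /=.
by rewrite subr0 mulrCA mulVf ?mulr1// lt0r_neq0// twopi_gt0.
Qed.

Lemma avg_derive F f : continuous f -> (forall x : R, is_derive x 1 F (f x)) ->
  avg f = (2 * pi)^-1 * (F (2 * pi) - F 0).
Proof.
move=> cf Ff; rewrite /avg /Rintegral (@continuous_FTC2 _ f F)//.
- exact: twopi_gt0.
- exact: continuous_subspaceT.
- have cF x : {for x, continuous F}.
    by apply/differentiable_continuous/derivable1_diffP; case: (Ff x).
  split.
  + by move=> x _; case: (Ff x).
  + by apply: cvg_at_right_filter; exact: cF.
  + by apply: cvg_at_left_filter; exact: cF.
- by move=> x _; rewrite derive1E; case: (Ff x) => _ ->.
Qed.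

Lemma avg_derive0 F f : continuous f -> (forall x : R, is_derive x 1 F (f x)) ->
  F (2 * pi) = F 0 -> avg f = 0.
Proof. by move=> cf Ff FF; rewrite (avg_derive cf Ff) FF subrr mulr0. Qed.

Lemma normr_avg_le f c : periodic_integrable f ->
  (forall x, `|f x| <= c) -> `|avg f| <= c.
Proof.
move=> fi fc; have ci : periodic_integrable (fun _ => c).
  exact/continuous_periodic_integrable/cont_cst.
have ci' : periodic_integrable (fun _ => - c).
  exact/continuous_periodic_integrable/cont_cst.
rewrite ler_norml; apply/andP; split.
  rewrite -[leLHS]avg_cst le_avg// => x.
  by have := fc x; rewrite ler_norml => /andP[].
rewrite -[leRHS]avg_cst le_avg// => x.
by have := fc x; rewrite ler_norml => /andP[].
Qed.

Lemma sinMint_2pi (m : int) : sin (m%:~R * (2 * pi)) = 0 :> R.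
Proof.
by have := expi_period (0 : R) m; rewrite add0r expi0 => -[].
Qed.

Lemma cosMint_2pi (m : int) : cos (m%:~R * (2 * pi)) = 1 :> R.
Proof.
by have := expi_period (0 : R) m; rewrite add0r expi0 => -[].
Qed.

Lemma avg_cosM (m : int) : m != 0 -> avg (fun x => cos (m%:~R * x)) = 0.
Proof.
move=> m0; apply: (@avg_derive0 (fun x => (m%:~R)^-1 * sin (m%:~R * x))).
- continuity.
- move=> x; apply: is_derive_eq.
  by rewrite /GRing.scale /=; field; rewrite intr_eq0.
- by rewrite sinMint_2pi !mulr0 sin0 mulr0.
Qed.

Lemma avg_sinM (m : int) : avg (fun x => sin (m%:~R * x)) = 0.
Proof.
have [->|m0] := eqVneq m 0.
  by under [X in avg X]eq_fun do rewrite mul0r sin0; rewrite avg_cst.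
apply: (@avg_derive0 (fun x => - (m%:~R)^-1 * cos (m%:~R * x))).
- continuity.
- move=> x; apply: is_derive_eq.
  by rewrite /GRing.scale /=; field; rewrite intr_eq0.
- by rewrite cosMint_2pi mulr0 cos0.
Qed.

End Average.

(** * Fourier coefficients and the area inequality *)

Section InnerProduct.
Context {R : realType}.
Implicit Types (F G H : R -> R[i]) (a : R[i]) (m n : int) (x : R).

Definition ccont F :=
  continuous (fun x => complex.Re (F x)) /\ continuous (fun x => complex.Im (F x)).

(** The real part of the $L^2$ inner product; over the reals the functions
    $e^{imx}$ and $ie^{imx}$ form an orthonormal family. *)
Definition ip F G : R :=
  avg (fun x => complex.Re (F x) * complex.Re (G x) +
                complex.Im (F x) * complex.Im (G x)).

Definition wave a m : R -> R[i] := fun x => a * expi (m%:~R * x).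

(** The Fourier coefficient of a periodic function on the line, assembled from
    real inner products. *)
Definition coef G m : R[i] := ip G (wave 1 m) +i* ip G (wave 'i m).

Definition trig (l : seq (R[i] * int)) : R -> R[i] :=
  fun x => \sum_(p <- l) wave p.1 p.2 x.

Lemma ccont_integrable F G : ccont F -> ccont G ->
  periodic_integrable (fun x => complex.Re (F x) * complex.Re (G x) +
                                complex.Im (F x) * complex.Im (G x)).
Proof.
by move=> [? ?] [? ?]; apply: continuous_periodic_integrable; continuity.
Qed.

Lemma ccont_parts F (p q : R -> R) : (forall x, complex.Re (F x) = p x) ->
  (forall x, complex.Im (F x) = q x) -> continuous p -> continuous q -> ccont F.
Proof. by move=> /funext Fp /funext Fq cp cq; rewrite /ccont Fp Fq. Qed.

Lemma ccontD F G : ccont F -> ccont G -> ccont (fun x => F x + G x).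
Proof.
move=> [? ?] [? ?].
by apply: ccont_parts => [x|x||]; [exact: ReD|exact: ImD|continuity|continuity].
Qed.

Lemma ccontN F : ccont F -> ccont (fun x => - F x).
Proof.
move=> [? ?].
by apply: ccont_parts => [x|x||]; [exact: ReN|exact: ImN|continuity|continuity].
Qed.

Lemma ccont_wave a m : ccont (wave a m).
Proof.
by apply: ccont_parts => [x|x||]; [rewrite ReM /=; reflexivity
  |rewrite ImM /=; reflexivity|continuity|continuity].
Qed.

Lemma ccont_sum (I : Type) (s : seq I) (F : I -> R -> R[i]) :
  (forall i, ccont (F i)) -> ccont (fun x => \sum_(i <- s) F i x).
Proof.
move=> cF; elim: s => [|i s IH].
  by under eq_fun do rewrite big_nil; split; exact: cont_cst.
by under eq_fun do rewrite big_cons; exact: ccontD.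
Qed.

Lemma ipC F G : ip F G = ip G F.
Proof. by apply: avg_ext => x; ring. Qed.

Lemma ipDr F G H : ccont F -> ccont G -> ccont H ->
  ip F (fun x => G x + H x) = ip F G + ip F H.
Proof.
move=> cF cG cH; rewrite /ip -avgD; [|exact: ccont_integrable..].
by apply: avg_ext => x; rewrite ReD ImD; ring.
Qed.

Lemma ipNr F G : ccont F -> ccont G -> ip F (fun x => - G x) = - ip F G.
Proof.
move=> cF cG; rewrite -mulN1r /ip -avgZ; last exact: ccont_integrable.
by apply: avg_ext => x; rewrite ReN ImN; ring.
Qed.

Lemma ipBr F G H : ccont F -> ccont G -> ccont H ->
  ip F (fun x => G x - H x) = ip F G - ip F H.
Proof.
by move=> cF cG cH; rewrite (ipDr (H := fun x => - H x))// ?ipNr//; exact: ccontN.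
Qed.

Lemma ip0r F : ip F (fun=> 0) = 0.
Proof. by rewrite -[RHS](avg_cst 0); apply: avg_ext => x /=; rewrite !mulr0 addr0. Qed.

Lemma ip_sumr (I : Type) (s : seq I) F (G : I -> R -> R[i]) : ccont F ->
  (forall i, ccont (G i)) ->
  ip F (fun x => \sum_(i <- s) G i x) = \sum_(i <- s) ip F (G i).
Proof.
move=> cF cG; elim: s => [|i s IH].
  by under [X in ip _ X]eq_fun do rewrite big_nil; rewrite big_nil ip0r.
under [X in ip _ X]eq_fun do rewrite big_cons.
by rewrite big_cons ipDr// ?IH//; exact: ccont_sum.
Qed.

Lemma ip_ge0 F : 0 <= ip F F.
Proof. by apply: avg_ge0 => x; rewrite addr_ge0// -expr2 sqr_ge0. Qed.

Lemma ip_le F (c : R) : ccont F -> (forall x, cabs (F x) <= c) -> ip F F <= c ^+ 2.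
Proof.
move=> cF Fc; rewrite -[leRHS]avg_cst le_avg//.
- exact: ccont_integrable.
- exact/continuous_periodic_integrable/cont_cst.
- move=> x; rewrite -!expr2 -sqr_cabs ler_sqr ?nnegrE ?cabs_ge0//.
  exact: le_trans (cabs_ge0 _) (Fc x).
Qed.

(** Arithmetic-geometric form of the Cauchy-Schwarz inequality. *)
Lemma ip_young F G (e : R) : 0 < e -> ccont F -> ccont G ->
  ip F G <= e * ip F F + e^-1 * ip G G.
Proof.
move=> e0 cF cG; rewrite /ip -!avgZ; [|exact: ccont_integrable..].
rewrite -avgD.
- apply: le_avg.
  + exact: ccont_integrable.
  + move: cF cG => [? ?] [? ?]; apply: continuous_periodic_integrable.
    by continuity.
  + move=> x; set a := complex.Re _; set b := complex.Re _.
    set c := complex.Im _; set d := complex.Im _.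
    have young (u v : R) : u * v <= e * (u * u) + e^-1 * (v * v).
      have := sqr_ge0 (e * u - v / 2).
      have : 0 <= v ^+ 2 by exact: sqr_ge0.
      rewrite -subr_ge0 => v2 h.
      rewrite -subr_ge0 -(pmulr_rge0 _ e0).
      have -> : e * (e * (u * u) + e^-1 * (v * v) - u * v) =
        (e * u - v / 2) ^+ 2 + 3 / 4 * v ^+ 2 by field; exact: lt0r_neq0.
      by lra.
    have := young a b; have := young c d; lra.
- by move: cF => [? ?]; apply: continuous_periodic_integrable; continuity.
- by move: cG => [? ?]; apply: continuous_periodic_integrable; continuity.
Qed.

Lemma ip_wave a m n b : ip (wave a m) (wave b n) =
  if m == n then complex.Re a * complex.Re b + complex.Im a * complex.Im b else 0.
Proof.
pose A := complex.Re a * complex.Re b + complex.Im a * complex.Im b.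
pose B := complex.Re a * complex.Im b - complex.Im a * complex.Re b.
have -> : ip (wave a m) (wave b n) =
    avg (fun x => A * cos ((m - n)%:~R * x) + B * sin ((m - n)%:~R * x)).
  apply: avg_ext => x; rewrite /wave !ReM !ImM /=.
  have -> : (m - n)%:~R * x = m%:~R * x - n%:~R * x by rewrite intrB mulrBl.
  rewrite cosB sinB /A /B.
  ring.
rewrite avgD ?avgZ; try by apply: continuous_periodic_integrable; continuity.
rewrite avg_sinM mulr0 addr0; have [->|mn] := eqVneq m n.
  rewrite subrr (_ : avg _ = 1) ?mulr1// -[RHS]avg_cst; apply: avg_ext => x.
  by rewrite mul0r cos0.
by rewrite avg_cosM ?mulr0// subr_eq0.
Qed.

Lemma ip_coef G a m : ccont G ->
  ip G (wave a m) = complex.Re a * complex.Re (coef G m) +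
                    complex.Im a * complex.Im (coef G m).
Proof.
move=> cG; rewrite /coef /= -!avgZ; [|exact: ccont_integrable (ccont_wave _ _)..].
rewrite -avgD; first by apply: avg_ext => x; rewrite /wave !ReM !ImM /=; ring.
all: have [? ?] := cG; have [? ?] := ccont_wave 1 m; have [? ?] := ccont_wave 'i m.
all: by apply: continuous_periodic_integrable; continuity.
Qed.

Definition remainder G (s : seq int) : R -> R[i] :=
  fun x => G x - \sum_(m <- s) wave (coef G m) m x.

Lemma ccont_partial G s : ccont (fun x => \sum_(m <- s) wave (coef G m) m x).
Proof. by apply: ccont_sum => m; exact: ccont_wave. Qed.

Lemma ccont_remainder G s : ccont G -> ccont (remainder G s).
Proof. by move=> cG; apply: ccontD => //; exact/ccontN/ccont_partial. Qed.

Lemma ip_remainder_wave G s a m : ccont G -> uniq s -> m \in s ->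
  ip (remainder G s) (wave a m) = 0.
Proof.
move=> cG us ms; have cw := ccont_wave a m.
rewrite ipC ipBr//; last exact: ccont_partial.
rewrite ip_sumr//; last by move=> ?; exact: ccont_wave.
rewrite (bigD1_seq m)//= big1 => [|n nm]; last by rewrite ip_wave eq_sym (negbTE nm).
by rewrite ipC ip_coef// ip_wave eqxx addr0 subrr.
Qed.

(** The truncated Fourier expansion is an orthogonal projection, hence the best
    approximation with the given frequencies. *)
Lemma ip_remainder_le G (l : seq (R[i] * int)) (s : seq int) : ccont G ->
  uniq s -> {subset [seq p.2 | p <- l] <= s} ->
  ip (remainder G s) (remainder G s) <=
  ip (fun x => G x - trig l x) (fun x => G x - trig l x).
Proof.
move=> cG us ls; set D := remainder G s; set E := fun x => _.
have cD : ccont D by exact: ccont_remainder.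
have cl : ccont (trig l) by apply: ccont_sum => p; exact: ccont_wave.
have cE : ccont E by apply: ccontD => //; exact: ccontN.
have DG : ip D D = ip D G.
  rewrite {2}/D /remainder ipBr//; last exact: ccont_partial.
  rewrite ip_sumr//; last by move=> ?; exact: ccont_wave.
  rewrite big_seq big1 ?subr0// => m ms; exact: ip_remainder_wave.
have DE : ip D D = ip D E.
  rewrite DG /E ipBr// ip_sumr//; last by move=> ?; exact: ccont_wave.
  rewrite big_seq big1 ?subr0// => p pl; apply: ip_remainder_wave => //.
  by apply: ls; apply/mapP; exists p.
have : 0 <= ip (fun x => D x - E x) (fun x => D x - E x) by exact: ip_ge0.
have cDE : ccont (fun x => D x - E x) by apply: ccontD => //; exact: ccontN.
rewrite (ipBr cDE cD cE) (ipC _ D) (ipC _ E) (ipBr cD cD cE) (ipBr cE cD cE).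
rewrite (ipC E D) -DE; lra.
Qed.

End InnerProduct.

Section AreaInequality.
Context {R : realType}.
Implicit Types (u : R[i] -> R[i]) (F G : R -> R[i]) (p q : R -> R) (m : int).

Definition H12sq u : \bar R := \esum_(n in [set n : int | n != 0])
  ((`|n|%N)%:R * cabs (fourier u n) ^+ 2)%:E.

Lemma H12normE u : H12norm u = sqrte (H12sq u).
Proof. by []. Qed.

Lemma H12sq_ge0 u : (0 <= H12sq u)%E.
Proof. by apply: esum_ge0 => n _; rewrite lee_fin mulr_ge0// sqr_ge0. Qed.

Lemma fourier_coef u G m : (forall x, u (expi x) = G x) -> fourier u m = coef G m.
Proof.
move=> uG; rewrite /fourier /circle_integral /coef /ip /avg.
apply: complex_ext; rewrite ?ReM ?ImM /= mul0r ?subr0 ?addr0; congr (_ * _);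
  apply: eq_Rintegral => x _; rewrite uG expi_exprz intrN mulNr ?ReM ?ImM /wave
   ?ReM ?ImM /= ?sinN ?cosN; ring.
Qed.

Lemma finite_sum_le_H12sq u (s : seq int) : uniq s ->
  ((\sum_(m <- s) m%:~R * cabs (fourier u m) ^+ 2)%:E <= H12sq u)%E.
Proof.
move=> us; apply: esum_ge.
exists [set` [seq m <- s | m != 0]].
  by split; [exact: finite_seq|move=> m /=; rewrite mem_filter => /andP[]].
rewrite -fsbig_seq ?filter_uniq// big_filter sumEFin lee_fin.
rewrite (bigID (fun m => m != 0)) /= [X in _ + X]big1 ?addr0; last first.
  by move=> m /negPn/eqP ->; rewrite mul0r.
apply: ler_sum => m _; rewrite ler_wpM2r ?sqr_ge0//.
by rewrite natr_absz ler_int ler_norm.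
Qed.

Definition trig_approximable G := forall d : R, 0 < d ->
  exists l, forall x, cabs (G x - trig l x) <= d.

(** Integration by parts: the operator $-i\,d/dx$ is symmetric and has $e^{imx}$
    as eigenvector with eigenvalue $m$. *)
Lemma ip_rotated_derivative_wave (p q p' q' : R -> R) a m :
  (forall x : R, is_derive x 1 p (p' x)) -> (forall x : R, is_derive x 1 q (q' x)) ->
  continuous p -> continuous q -> continuous p' -> continuous q' ->
  p (2 * pi) = p 0 -> q (2 * pi) = q 0 ->
  ip (fun x => q' x -i* p' x) (wave a m) =
  m%:~R * ip (fun x => p x +i* q x) (wave a m).
Proof.
move=> dp dq cp cq cp' cq' pp qp.
have cG : ccont (fun x => p x +i* q x) by [].
have cW : ccont (fun x => q' x -i* p' x).
  by split => //=; exact: cont_opp.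
rewrite /ip -avgZ; last exact: ccont_integrable (ccont_wave _ _).
apply/eqP; rewrite -subr_eq0 -mulN1r -avgZ; last first.
  have [? ?] := @ccont_wave _ a m.
  by apply: continuous_periodic_integrable => /=; continuity.
have [? ?] := @ccont_wave _ a m.
rewrite -avgD; try by apply: continuous_periodic_integrable => /=; continuity.
pose al x := complex.Re a * cos (m%:~R * x) - complex.Im a * sin (m%:~R * x).
pose be x := complex.Re a * sin (m%:~R * x) + complex.Im a * cos (m%:~R * x).
have dal (x : R) : is_derive x 1 al (- (m%:~R * be x)).
  by apply: is_derive_eq; rewrite /be /GRing.scale /=; ring.
have dbe (x : R) : is_derive x 1 be (m%:~R * al x).
  by apply: is_derive_eq; rewrite /al /GRing.scale /=; ring.
apply/eqP; apply: (@avg_derive0 _ (fun x => q x * al x - p x * be x)).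
- by move=> /=; continuity.
- move=> x; have h1 := @is_deriveM R _ _ _ x 1 _ _ (dq x) (dal x).
  have h2 := @is_deriveM R _ _ _ x 1 _ _ (dp x) (dbe x).
  have h3 := @is_deriveB R _ _ _ _ x 1 _ _ h1 h2.
  apply: (is_derive_eq h3).
  by rewrite /wave !ReM !ImM /= -/(al x) -/(be x) /GRing.scale /=; ring.
- rewrite /al /be !mulr0 sinMint_2pi cosMint_2pi sin0 cos0 pp qp; ring.
Qed.

(** With $G=p+iq$ the left-hand side is the inner product of $-iG'$ and $G$.
    Since $-iG'$ has the coefficients $mc_m$, replacing $G$ by a partial sum of
    its Fourier series gives $\sum m|c_m|^2$, a part of the squared norm with
    some signs reversed. The remainder of $G$ is small in mean square by
    comparison with an approximating trigonometric polynomial. *)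
Lemma area_le_H12sq u (p q p' q' : R -> R) :
  (forall x, u (expi x) = p x +i* q x) ->
  (forall x : R, is_derive x 1 p (p' x)) -> (forall x : R, is_derive x 1 q (q' x)) ->
  continuous p' -> continuous q' -> trig_approximable (fun x => p x +i* q x) ->
  ((avg (fun x => p x * q' x - q x * p' x))%:E <= H12sq u)%E.
Proof.
move=> uG dp dq cp' cq' aG; set G := (fun x => p x +i* q x) in uG aG.
have der_cont (f f' : R -> R) : (forall x : R, is_derive x 1 f (f' x)) -> continuous f.
  by move=> df x; apply: differentiable_continuous; apply/derivable1_diffP; case: (df x).
have cp := der_cont _ _ dp; have cq := der_cont _ _ dq.
have [pp qp] : p (2 * pi) = p 0 /\ q (2 * pi) = q 0.
  have := uG (2 * pi); rewrite expi2pi -expi0 uG.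
  by case=> -> ->.
have cG : ccont G by [].
pose W x : R[i] := q' x -i* p' x.
have cW : ccont W by split => //=; exact: cont_opp.
have QE : avg (fun x => p x * q' x - q x * p' x) = ip W G.
  by apply: avg_ext => x /=; ring.
have Ww a m : ip W (wave a m) = m%:~R * ip G (wave a m).
  exact: ip_rotated_derivative_wave.
have [->|] := eqVneq (H12sq u) +oo%E; first by rewrite leey.
move=> Hfin; have Bf : H12sq u \is a fin_num.
  by rewrite ge0_fin_numE ?H12sq_ge0// ltey.
rewrite -(fineK Bf) lee_fin QE; apply/ler_addgt0Pr => eta eta0.
have WW0 : 0 <= ip W W by exact: ip_ge0.
(* The weight [e] makes both terms of [ip_young] at most [eta / 2]. *)
pose e := eta / (2 * (ip W W + 1)).
have e0 : 0 < e by rewrite divr_gt0// mulr_gt0// ltr_wpDl.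
have de : 0 < e * eta / 2 by rewrite divr_gt0// mulr_gt0.
have sde : 0 < Num.sqrt (e * eta / 2) by rewrite sqrtr_gt0.
have [l Gl] := aG _ sde.
pose s := undup [seq z.2 | z <- l].
have us : uniq s by exact: undup_uniq.
have ls : {subset [seq z.2 | z <- l] <= s} by move=> m; rewrite mem_undup.
have cl : ccont (trig l) by apply: ccont_sum => ?; exact: ccont_wave.
have DD : ip (remainder G s) (remainder G s) <= e * eta / 2.
  apply: le_trans (ip_remainder_le cG us ls) _.
  rewrite -[leRHS](sqr_sqrtr (ltW de)); apply: ip_le => //.
  by apply: ccontD => //; exact: ccontN.
have cD : ccont (remainder G s) by exact: ccont_remainder.
have -> : ip W G = ip W (remainder G s) +
    \sum_(m <- s) m%:~R * cabs (fourier u m) ^+ 2.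
  rewrite /remainder ipBr//; last exact: ccont_partial.
  rewrite ip_sumr//; last by move=> ?; exact: ccont_wave.
  rewrite -[LHS](subrK (\sum_(m <- s) ip W (wave (coef G m) m))); congr (_ + _).
  apply: eq_bigr => m _; rewrite Ww ip_coef// (fourier_coef _ uG) sqr_cabs.
  by rewrite -!expr2.
have h1 : \sum_(m <- s) m%:~R * cabs (fourier u m) ^+ 2 <= fine (H12sq u).
  by rewrite -lee_fin fineK// finite_sum_le_H12sq.
have h2 : e^-1 * ip (remainder G s) (remainder G s) <= eta / 2.
  rewrite mulrC ler_pdivrMr//; lra.
have h3 : e * ip W W <= eta / 2.
  have -> : e * ip W W = eta / 2 * (ip W W / (ip W W + 1)).
    by rewrite /e; field; apply: lt0r_neq0; lra.
  rewrite ler_piMr ?divr_ge0 ?(ltW eta0)//.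
  by rewrite ler_pdivrMr ?ltr_wpDl// mul1r lerDl.
have := ip_young e0 cW cD; lra.
Qed.

End AreaInequality.

(** * Trigonometric approximation *)

Section TrigApproximation.
Context {R : realType}.
Implicit Types (F G : R -> R[i]) (x y : R).

Lemma trigD (l1 l2 : seq (R[i] * int)) x :
  trig (l1 ++ l2) x = trig l1 x + trig l2 x.
Proof. by rewrite /trig big_cat. Qed.

Lemma trig1 (a : R[i]) (m : int) x : trig [:: (a, m)] x = wave a m x.
Proof. by rewrite /trig big_seq1. Qed.

Lemma trigM (l1 l2 : seq (R[i] * int)) :
  exists l, forall x, trig l x = trig l1 x * trig l2 x.
Proof.
exists [seq (z.1 * w.1, z.2 + w.2) | z <- l1, w <- l2] => x.
rewrite /trig big_allpairs_dep mulr_suml; apply: eq_bigr => z _.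
rewrite mulr_sumr; apply: eq_bigr => w _.
by rewrite /wave /= intrD mulrDl expiD; ring.
Qed.

Lemma trigX (l : seq (R[i] * int)) (n : nat) :
  exists l', forall x, trig l' x = trig l x ^+ n.
Proof.
elim: n => [|n [l' IH]].
  by exists [:: (1, 0)] => x; rewrite trig1 /wave mul0r expi0 mulr1 expr0.
by have [l2 E] := trigM l l'; exists l2 => x; rewrite E IH exprS.
Qed.

Lemma trig_horner (l : seq (R[i] * int)) (a : nat -> R[i]) (N : nat) :
  exists l', forall x, trig l' x = \sum_(0 <= k < N) a k * trig l x ^+ k.
Proof.
elim: N => [|N [l' IH]].
  by exists [::] => x; rewrite /trig big_nil big_geq.
have [l1 E1] := trigX l N; have [l2 E2] := trigM [:: (a N, 0)] l1.
exists (l' ++ l2) => x; rewrite trigD IH E2 E1 trig1 big_nat_recr//=.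
by rewrite /wave mul0r expi0 mulr1.
Qed.

Lemma trig_approximableD F G : trig_approximable F -> trig_approximable G ->
  trig_approximable (fun x => F x + G x).
Proof.
move=> aF aG d d0; have d2 : 0 < d / 2 by rewrite divr_gt0.
have [l1 F1] := aF _ d2; have [l2 G2] := aG _ d2.
exists (l1 ++ l2) => x; rewrite trigD.
have -> : F x + G x - (trig l1 x + trig l2 x) =
  (F x - trig l1 x) + (G x - trig l2 x) by ring.
by have := cabsD (F x - trig l1 x) (G x - trig l2 x); have := F1 x; have := G2 x; lra.
Qed.

Lemma trig_approximableM (a : R[i]) (m : int) G : trig_approximable G ->
  trig_approximable (fun x => wave a m x * G x).
Proof.
move=> aG d d0; have a0 : 0 < cabs a + 1 by rewrite ltr_wpDl ?cabs_ge0.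
have [l Gl] := aG (d / (cabs a + 1)) (divr_gt0 d0 a0).
have [l' E] := trigM [:: (a, m)] l; exists l' => x.
rewrite E trig1 -mulrBr !cabsM cabs_expi mulr1.
have := Gl x; rewrite ler_pdivlMr// => h; have := cabs_ge0 (G x - trig l x).
by have := cabs_ge0 a; lra.
Qed.

Lemma series_tail_le (a b : R^nat) (la lb : R) (N : nat) :
  series a @ \oo --> la -> series b @ \oo --> lb ->
  (forall n, `|a n| <= b n) -> `|la - series a N| <= lb - series b N.
Proof.
move=> ca cb ab.
have c1 : (fun M => `|series a M - series a N|) @ \oo --> `|la - series a N|.
  by apply: cvg_norm; apply: cvgB => //; exact: cvg_cst.
have c2 : (fun M => series b M - series b N) @ \oo --> lb - series b N.
  by apply: cvgB => //; exact: cvg_cst.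
apply: (ler_cvg_to c1 c2); near=> M.
have NM : (N <= M)%N by near: M; exact: nbhs_infty_ge.
rewrite !sub_series_geq//; apply: le_trans (ler_norm_sum _ _ _) _.
by apply: ler_sum => i _.
Unshelve. all: by end_near. Qed.

(** Taylor polynomials of $e^{iy}$ converge uniformly on bounded intervals,
    dominated by the exponential series. *)
Lemma expi_taylor (L d : R) : 0 < d -> exists N : nat, forall y, `|y| <= L ->
  cabs (expi y - \sum_(0 <= k < N) (cos_coeff 1 k +i* sin_coeff 1 k) * (y%:C) ^+ k) <= d.
Proof.
move=> d0.
have cE : series (exp_coeff L) @ \oo --> expR L by exact: is_cvg_series_exp_coeff.
have [N _ hN] : \forall N \near \oo, `|expR L - series (exp_coeff L) N| < d / 2.
  by move/cvgrPdist_lt: cE; apply; rewrite divr_gt0.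
exists N => y yL.
have tail (c : R^nat) (l : R) : series c @ \oo --> l ->
    (forall n, `|c n| <= exp_coeff L n) -> `|l - series c N| <= d / 2.
  move=> cl cL; apply: le_trans (series_tail_le N cl cE cL) _.
  exact: le_trans (ler_norm _) (ltW (hN N (leqnn N))).
have bound n (e : R) : `|e| <= 1 -> `|e * y ^+ n / n`!%:R| <= exp_coeff L n.
  move=> e1; rewrite /exp_coeff /= normrM normrM normrX normfV normr_nat.
  rewrite ler_wpM2r ?invr_ge0//; apply: le_trans (_ : 1 * L ^+ n <= _); last first.
    by rewrite mul1r.
  by rewrite ler_pM ?exprn_ge0// lerXn2r ?nnegrE// (le_trans _ yL).
have sgn n (b : bool) : `|b%:R * (-1) ^+ n| <= 1 :> R.
  by rewrite normrM normr_sign mulr1; case: b; rewrite ?normr1 ?normr0.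
have hc := tail _ (cos y) _ (fun n => bound n _ (sgn n./2 (~~ odd n))).
have hs := tail _ (sin y) _ (fun n => bound n _ (sgn n.-1./2 (odd n))).
have {}hc : `|cos y - series (cos_coeff y) N| <= d / 2.
  by apply: hc; rewrite unlock; exact: is_cvg_series_cos_coeff.
have {}hs : `|sin y - series (sin_coeff y) N| <= d / 2.
  by apply: hs; rewrite unlock; exact: is_cvg_series_sin_coeff.
have -> : \sum_(0 <= k < N) (cos_coeff 1 k +i* sin_coeff 1 k) * y%:C ^+ k =
    series (cos_coeff y) N +i* series (sin_coeff y) N.
  rewrite /series /=; elim: N {hN tail hc hs} => [|N IH]; first by rewrite !big_geq.
  rewrite !big_nat_recr//= IH -rmorphXn /=.
  have cE1 : cos_coeff y N = cos_coeff 1 N * y ^+ N.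
    by rewrite /cos_coeff /= expr1n mulr1 mulrAC.
  have sE1 : sin_coeff y N = sin_coeff 1 N * y ^+ N.
    by rewrite /sin_coeff /= expr1n mulr1 mulrAC.
  by apply: complex_ext; rewrite ?ReD ?ImD ?ReM ?ImM cE1 sE1 /=; ring.
apply: le_trans (cabs_le_ReIm _) _; rewrite ReD ImD ReN ImN /=; lra.
Qed.

Lemma trig_approximable_twist (c : R) :
  trig_approximable (fun x => expi (c * sin (2 * x))).
Proof.
move=> d d0; have [N hN] := expi_taylor `|c| d0.
pose l : seq (R[i] * int) := [:: ((- (c / 2)) *i, 2 : int); ((c / 2) *i, - (2 : int))].
have lE x : trig l x = (c * sin (2 * x))%:C.
  rewrite /trig /l !big_cons big_nil addr0 /wave /= intrN mulNr.
  by apply: complex_ext; rewrite ?ReD ?ImD ?ReM ?ImM /= ?sinN ?cosN; field.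
have [l' E] := trig_horner l (fun k => cos_coeff 1 k +i* sin_coeff 1 k) N.
exists l' => x; rewrite E lE; apply: hN.
by rewrite normrM ler_piMr// sin_max.
Qed.

Lemma trig_approximable_wave_lift (a t : R) (n : int) :
  trig_approximable (fun x => wave a%:C 0 x * expi (n%:~R * lift t x)).
Proof.
have -> : (fun x => wave a%:C 0 x * expi (n%:~R * lift t x)) =
    (fun x => wave a%:C n x * expi (n%:~R * t * sin (2 * x))).
  apply/funext => x; rewrite /wave mul0r expi0 mulr1 -mulrA -expiD.
  by congr (_ * expi _); rewrite /lift; ring.
exact/trig_approximableM/trig_approximable_twist.
Qed.

End TrigApproximation.

(** * Decay of the diagonal oscillatory integral *)

Section Bessel.
Context {R : realType}.
Implicit Types (x : R) (k n : nat).

Local Notation s x := (sin (2 * x)).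
Local Notation c x := (cos (2 * x)).

Lemma is_derive_s x : is_derive x 1 (fun x => s x) (2 * c x).
Proof. by apply: is_derive_eq; rewrite /GRing.scale /=; ring. Qed.

Lemma is_derive_c x : is_derive x 1 (fun x => c x) (- (2 * s x)).
Proof. by apply: is_derive_eq; rewrite /GRing.scale /=; ring. Qed.

Lemma is_derive_sX n x :
  is_derive x 1 (fun x => s x ^+ n.+1) (n.+1%:R * s x ^+ n * (2 * c x)).
Proof.
have -> : (fun x => s x ^+ n.+1) = (fun x => s x) ^+ n.+1.
  by apply/funext => y; rewrite exprfctE.
exact: (@is_deriveX R _ _ n.+1 x 1 _ (is_derive_s x)).
Qed.

Lemma s_2pi : s (2 * pi) = 0 :> R.
Proof. by have := @sinMint_2pi R 2. Qed.

Lemma s_0 : s 0 = 0 :> R.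
Proof. by rewrite mulr0 sin0. Qed.

(** The Wallis integral: it obeys the recurrence below and is of order
    $k^{-1/2}$. *)
Definition wallis k : R := avg (fun x => s x ^+ k.*2).

Lemma wallisS k : k.*2.+2%:R * wallis k.+1 = k.*2.+1%:R * wallis k.
Proof.
apply/eqP; rewrite eq_sym -subr_eq0 -mulNr /wallis -!avgZ; last 2 first.
- by apply: continuous_periodic_integrable; continuity.
- by apply: continuous_periodic_integrable; continuity.
rewrite -avgD; try by apply: continuous_periodic_integrable; continuity.
apply/eqP; apply: (@avg_derive0 _ (fun x => 2^-1 * (s x ^+ k.*2.+1 * c x))).
- by continuity.
- move=> x; have h := @is_deriveM R _ _ _ x 1 _ _ (is_derive_sX k.*2 x) (is_derive_c x).
  have h2 := @is_deriveZ R _ _ _ 2^-1 x 1 _ h.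
  apply: (is_derive_eq h2); rewrite /GRing.scale /= doubleS !exprS.
  have c2 : c x ^+ 2 = 1 - s x ^+ 2 by exact: cos2sin2.
  rewrite -(natr1 k.*2.+1) -(natr1 k.*2).
  by field: c2.
- by rewrite s_2pi s_0 !expr0n /= !mul0r.
Qed.

Lemma wallis_ge0 k : 0 <= wallis k.
Proof. by apply: avg_ge0 => x; rewrite -mul2n exprM exprn_ge0 ?sqr_ge0. Qed.

Lemma wallis_sqr_le k : k.*2.+1%:R * wallis k ^+ 2 <= 1.
Proof.
elim: k => [|k IH].
  rewrite /wallis (_ : avg _ = 1) ?expr1n ?mulr1//.
  by rewrite -[RHS]avg_cst; apply: avg_ext => x; rewrite expr0.
have E := wallisS k.
have a0 : 0 <= k.*2%:R :> R by [].
move: E IH; rewrite doubleS -!natr1; set a := k.*2%:R in a0 *.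
set u := wallis k; set v := wallis k.+1 => E IH.
have a2 : 0 < a + 1 + 1 by lra.
have -> : v = (a + 1) * u / (a + 1 + 1).
  by rewrite -E mulrC mulKf// lt0r_neq0.
rewrite expr_div_n mulrA ler_pdivrMr ?exprn_gt0// mul1r.
rewrite exprMn.
have -> : (a + 1 + 1 + 1) * ((a + 1) ^+ 2 * u ^+ 2) =
  (a + 1 + 1 + 1) * (a + 1) * ((a + 1) * u ^+ 2) by ring.
apply: le_trans (_ : (a + 1 + 1 + 1) * (a + 1) * 1 <= _).
  by rewrite ler_wpM2l// mulr_ge0//; lra.
by rewrite mulr1 -subr_ge0; have -> : (a + 1 + 1) ^+ 2 - (a + 1 + 1 + 1) * (a + 1) = 1 by ring.
Qed.

Lemma wallis_small (e : R) : 0 < e -> exists k, wallis k <= e.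
Proof.
move=> e0; pose k := Num.bound (e ^- 2); exists k.
have hk : e ^- 2 < k%:R.
  by apply: archi_boundP; rewrite invr_ge0 exprn_ge0// ltW.
have w := wallis_sqr_le k.
rewrite -(@ler_pXn2r _ 2)// ?nnegrE ?wallis_ge0 ?(ltW e0)//.
have k0 : 0 < k.*2.+1%:R :> R by [].
have h1 : wallis k ^+ 2 <= (k.*2.+1%:R)^-1.
  by rewrite -[leRHS]mul1r ler_pdivlMr// mulrC.
apply: le_trans h1 _; rewrite -[leRHS]invrK lef_pV2 ?posrE ?invr_gt0 ?exprn_gt0//.
apply/ltW/(lt_le_trans hk); rewrite ler_nat -addnn; lia.
Qed.

(** Only the existence of a continuous derivative matters: its size is absorbed
    by letting the frequency grow. *)
Lemma is_derive_weight k : exists2 D : R -> R, continuous D &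
  forall x, is_derive x 1 (fun x => c x * \sum_(j < k) (s x ^+ 2) ^+ j) (D x).
Proof.
elim: k => [|k [D cD dD]].
  exists (fun=> 0) => [|x]; first by continuity.
  by under eq_fun do rewrite big_ord0 mulr0; exact: is_derive_cst.
have [D' cD' dD'] : exists2 D : R -> R, continuous D &
    forall x, is_derive x 1 (fun x => c x * (s x ^+ 2) ^+ k) (D x).
  case: k {cD dD} => [|k].
    exists (fun x => - (2 * s x)) => [|x]; first by continuity.
    by under eq_fun do rewrite expr0 mulr1; exact: is_derive_c.
  exists (fun x => c x * ((k.*2.+2)%:R * s x ^+ k.*2.+1 * (2 * c x)) +
                   s x ^+ k.*2.+2 * (- (2 * s x))).
    by continuity.
  move=> x; under eq_fun do rewrite -exprM mul2n doubleS.
  have := @is_deriveM R _ _ _ x 1 _ _ (is_derive_c x) (is_derive_sX k.*2.+1 x).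
  by move=> h; exact: (is_derive_eq h).
exists (fun x => D x + D' x) => [|x]; first by continuity.
under eq_fun do rewrite big_ord_recr /= mulrDr.
exact: (@is_deriveD R _ _ _ _ x 1 _ _ (dD x) (dD' x)).
Qed.

(** The phase $\sin 2x$ is stationary where $\cos 2x=0$. Writing
    $1=s^{2k}+\cos^2(2x)\sum_{j<k}s^{2j}$ isolates the stationary points: the
    first term has small mean by Wallis, and the factor $\cos 2x$ in the second
    permits an integration by parts. *)
Lemma oscillatory_avg_small (e : R) : 0 < e ->
  exists L : R, forall l : R, L <= l -> `|avg (fun x => cos (l * s x))| <= e.
Proof.
move=> e0; have e2 : 0 < e / 2 by rewrite divr_gt0.
have [k Wk] := wallis_small e2.
have [D cD dD] := is_derive_weight k.
pose P x := \sum_(j < k) (s x ^+ 2) ^+ j.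
have cP : continuous P by apply: cont_sum => j; continuity.
pose K := 1 + avg (fun x => D x ^+ 2).
have K0 : 0 < K by rewrite ltr_pwDl// avg_ge0// => x; rewrite sqr_ge0.
(* The integration by parts costs at most [K / (2 * l)]. *)
exists (K / e) => l Ll.
have l0 : 0 < l by apply: lt_le_trans Ll; rewrite divr_gt0.
have int f : continuous f -> periodic_integrable f by exact: continuous_periodic_integrable.
have split : avg (fun x => cos (l * s x)) =
    avg (fun x => cos (l * s x) * s x ^+ k.*2) +
    avg (fun x => cos (l * s x) * (c x * (c x * P x))).
  rewrite -avgD; try by apply: int; continuity.
  apply: avg_ext => x; rewrite -mulrDr -[LHS]mulr1; congr (_ * _).
  have := subrX1 (s x ^+ 2) k; rewrite -/(P x) -exprM mul2n mulrA -expr2.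
  by rewrite cos2sin2; lra.
have parts : avg (fun x => cos (l * s x) * (c x * (c x * P x))) =
    - (2 * l)^-1 * avg (fun x => sin (l * s x) * D x).
  apply/eqP; rewrite mulNr -subr_eq0 opprK -avgZ; last by apply: int; continuity.
  rewrite -avgD; try by apply: int; continuity.
  apply/eqP; apply: (@avg_derive0 _
    (fun x => (2 * l)^-1 * (sin (l * s x) * (c x * P x)))).
  - by continuity.
  - move=> x.
    have h1 : is_derive x 1 (fun x => sin (l * s x)) (cos (l * s x) * (l * (2 * c x))).
      have h0 := @is_deriveZ R _ _ _ l x 1 _ (is_derive_s x).
      exact: (@is_derive1_comp R sin _ x _ _ (is_derive_sin _) h0).
    have h2 := @is_deriveM R _ _ _ x 1 _ _ h1 (dD x).
    have h3 := @is_deriveZ R _ _ _ (2 * l)^-1 x 1 _ h2.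
    apply: (is_derive_eq h3); rewrite /GRing.scale /= -/(P x).
    by field; exact: lt0r_neq0.
  - by rewrite s_2pi s_0 !mulr0 sin0 !mul0r !mulr0.
have b1 : `|avg (fun x => cos (l * s x) * s x ^+ k.*2)| <= e / 2.
  apply: le_trans Wk; rewrite ler_norml -mulN1r /wallis -avgZ; last first.
    by apply: int; continuity.
  have bx x : `|cos (l * s x) * s x ^+ k.*2| <= s x ^+ k.*2.
    have p : 0 <= s x ^+ k.*2 by rewrite -mul2n exprM exprn_ge0 ?sqr_ge0.
    by rewrite normrM (ger0_norm p) ler_piMl// cos_max.
  apply/andP; split; apply: le_avg; try by apply: int; continuity.
    by move=> x; have := bx x; rewrite ler_norml mulN1r => /andP[].
  by move=> x; have := bx x; rewrite ler_norml => /andP[].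
have b2 : `|avg (fun x => sin (l * s x) * D x)| <= K.
  have cK : K = avg (fun x => 1 + D x ^+ 2).
    by rewrite avgD ?avg_cst//; apply: int; continuity.
  have bx x : `|sin (l * s x) * D x| <= 1 + D x ^+ 2.
    have h := sin_max (l * s x).
    rewrite normrM; apply: le_trans (_ : 1 * `|D x| <= _); first by rewrite ler_wpM2r.
    rewrite mul1r -[X in _ <= _ + X]real_normK ?num_real//.
    by have := sqr_ge0 (`|D x| - 1 / 2); lra.
  rewrite cK ler_norml -mulN1r -avgZ; last by apply: int; continuity.
  apply/andP; split; apply: le_avg; try by apply: int; continuity.
    by move=> x; have := bx x; rewrite ler_norml mulN1r => /andP[].
  by move=> x; have := bx x; rewrite ler_norml => /andP[].
rewrite split parts; apply: le_trans (ler_normD _ _) _.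
rewrite (normrM (- (2 * l)^-1)) normrN (gtr0_norm (_ : 0 < (2 * l)^-1)) ?invr_gt0 ?mulr_gt0//.
have : (2 * l)^-1 * `|avg (fun x => sin (l * s x) * D x)| <= e / 2.
  rewrite mulrC ler_pdivrMr ?mulr_gt0//; apply: le_trans b2 _.
  by have := Ll; rewrite ler_pdivrMr//; lra.
lra.
Qed.

End Bessel.

(** * The seminorm of the Dirichlet space *)

Section DirichletSeminorm.
Context {R : realType}.
Implicit Types (u v f g : R[i] -> R[i]) (m n : int).

Lemma circle_integrableP u : circle_integrable u <->
  periodic_integrable (fun x => complex.Re (u (expi x))) /\
  periodic_integrable (fun x => complex.Im (u (expi x))).
Proof. by []. Qed.

Lemma circle_integrableD f g : circle_integrable f -> circle_integrable g ->
  circle_integrable (fun w => f w + g w).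
Proof.
move=> [f1 f2] [g1 g2]; apply/circle_integrableP; split.
  rewrite (_ : (fun x => _) = (fun x => complex.Re (f (expi x)) + complex.Re (g (expi x)))).
    exact: periodic_integrableD.
  by apply/funext => x; rewrite ReD.
rewrite (_ : (fun x => _) = (fun x => complex.Im (f (expi x)) + complex.Im (g (expi x)))).
  exact: periodic_integrableD.
by apply/funext => x; rewrite ImD.
Qed.

Lemma circle_integrableN f : circle_integrable f ->
  circle_integrable (fun w => - f w).
Proof.
have cN1 : continuous (fun _ : R => -1 : R) by exact: cont_cst.
move=> [f1 f2]; apply/circle_integrableP; split.
  rewrite (_ : (fun x => _) = (fun x => complex.Re (f (expi x)) * -1)).
    exact: periodic_integrableM.
  by apply/funext => x; rewrite ReN mulrN1.
rewrite (_ : (fun x => _) = (fun x => complex.Im (f (expi x)) * -1)).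
  exact: periodic_integrableM.
by apply/funext => x; rewrite ImN mulrN1.
Qed.

Lemma ccont_circle_integrable u (G : R -> R[i]) :
  (forall x, u (expi x) = G x) -> ccont G -> circle_integrable u.
Proof.
move=> uG [c1 c2]; apply/circle_integrableP.
have -> : (fun x => complex.Re (u (expi x))) = (fun x => complex.Re (G x)).
  by apply/funext => x; rewrite uG.
have -> : (fun x => complex.Im (u (expi x))) = (fun x => complex.Im (G x)).
  by apply/funext => x; rewrite uG.
by split; exact: continuous_periodic_integrable.
Qed.

Lemma fourierD f g m : circle_integrable f -> circle_integrable g ->
  fourier (fun w => f w + g w) m = fourier f m + fourier g m.
Proof.
move=> [f1 f2] [g1 g2].
have key (a : R[i]) : ip (fun x => f (expi x) + g (expi x)) (wave a m) =
    ip (fun x => f (expi x)) (wave a m) + ip (fun x => g (expi x)) (wave a m).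
  have [c1 c2] := ccont_wave a m.
  rewrite /ip -avgD; first by apply: avg_ext => x; rewrite ReD ImD; ring.
    by apply: periodic_integrableD; exact: periodic_integrableM.
  by apply: periodic_integrableD; exact: periodic_integrableM.
rewrite !(fourier_coef _ (fun=> erefl)) /coef !key.
by apply: complex_ext; rewrite ?ReD ?ImD.
Qed.

Lemma fourierN f m : circle_integrable f ->
  fourier (fun w => - f w) m = - fourier f m.
Proof.
move=> fi; apply/eqP; rewrite -addr_eq0 -fourierD//; last exact: circle_integrableN.
rewrite (_ : (fun w => _) = (fun=> 0)); last by apply/funext => w; rewrite addNr.
rewrite (fourier_coef m (G := fun=> 0))// /coef !(ipC (fun=> 0)) !ip0r.
by rewrite eq_complex /= !eqxx.
Qed.

Lemma H12sqN f : circle_integrable f -> H12sq (fun w => - f w) = H12sq f.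
Proof. by move=> fi; apply: eq_esum => m _; rewrite fourierN// cabsN. Qed.

Lemma ge0_esumZ_le (I : choiceType) (D : set I) (c : R) (a : I -> \bar R) :
  0 <= c -> (forall i, 0 <= a i)%E ->
  (\esum_(i in D) (c%:E * a i) <= c%:E * \esum_(i in D) a i)%E.
Proof.
move=> c0 a0; apply: ge_ereal_sup => _ [X [finX XD] <-].
rewrite -ge0_mule_fsumr//; apply: lee_wpmul2l; first by rewrite lee_fin.
by apply: esum_ge; exists X.
Qed.

(** The triangle inequality in quadratic form. It holds termwise, which spares
    any appeal to the Minkowski inequality. *)
Lemma H12sqD (e : R) f g : 0 < e -> circle_integrable f -> circle_integrable g ->
  (H12sq (fun w => f w + g w)%R <=
     (1 + e)%R%:E * H12sq f + (1 + e^-1)%R%:E * H12sq g)%E.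
Proof.
move=> e0 fi gi; have e1 : 0 < e^-1 by rewrite invr_gt0.
pose a u n : \bar R := ((`|n|%N)%:R * cabs (fourier u n) ^+ 2)%:E.
have a0 u n : (0 <= a u n)%E by rewrite lee_fin mulr_ge0// sqr_ge0.
apply: (@le_trans _ _ (\esum_(n in [set n : int | n != 0%R])
   ((1 + e)%R%:E * a f n + (1 + e^-1)%R%:E * a g n))%E); last first.
  rewrite esumD; last 2 first.
  - by move=> n _; rewrite mule_ge0// lee_fin; lra.
  - by move=> n _; rewrite mule_ge0// lee_fin; lra.
  by apply: leeD; apply: ge0_esumZ_le => //; lra.
apply: le_esum => n _; rewrite fourierD// /a -!EFinM -EFinD lee_fin.
set p := cabs (fourier f n); set q := cabs (fourier g n).
have p0 : 0 <= p by exact: cabs_ge0.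
have q0 : 0 <= q by exact: cabs_ge0.
have core : cabs (fourier f n + fourier g n) ^+ 2 <=
    (1 + e) * p ^+ 2 + (1 + e^-1) * q ^+ 2.
  apply: (@le_trans _ _ ((p + q) ^+ 2)).
    by rewrite ler_sqr ?nnegrE ?addr_ge0 ?cabs_ge0// cabsD.
  rewrite -subr_ge0 -(pmulr_rge0 _ e0).
  have -> : e * ((1 + e) * p ^+ 2 + (1 + e^-1) * q ^+ 2 - (p + q) ^+ 2) =
    (e * p - q) ^+ 2 by field; exact: lt0r_neq0.
  exact: sqr_ge0.
apply: le_trans (ler_wpM2l (ler0n _ _) core) _.
by rewrite le_eqVlt; apply/orP; left; apply/eqP; ring.
Qed.

Lemma H12norm_le u (c : R) : 0 <= c ->
  (H12norm u <= c%:E)%E = (H12sq u <= (c ^+ 2)%:E)%E.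
Proof.
move=> c0; rewrite H12normE.
have -> : c%:E = sqrte (c ^+ 2)%:E by rewrite /= sqrtr_sqr ger0_norm.
by rewrite lee_sqrt// lee_fin sqr_ge0.
Qed.

(** * Pure oscillations *)

(** The scale is chosen so that the squared seminorm of a mode is 1/2 and that
    of a difference of two distinct modes is 1. *)
Definition mode_scale (n : nat) : R := (Num.sqrt (2 * n%:R))^-1.

Definition mode (n : nat) (w : R[i]) : R[i] := (mode_scale n)%:C * w ^+ n.

Lemma mode_scale_sqr (n : nat) : (0 < n)%N -> n%:R * mode_scale n ^+ 2 = 1 / 2.
Proof.
move=> n0; rewrite /mode_scale exprVn sqr_sqrtr ?mulr_ge0//.
by field; rewrite pnatr_eq0 -lt0n.
Qed.

Lemma mode_expi (n : nat) x : mode n (expi x) = wave (mode_scale n)%:C n x.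
Proof. by rewrite /mode expiX. Qed.

Lemma fourier_mode (n : nat) m :
  fourier (mode n) m = if m == n then (mode_scale n)%:C else 0.
Proof.
rewrite (fourier_coef m (mode_expi n)) /coef !ip_wave /= eq_sym.
by case: eqP => _; rewrite ?mulr1 ?mulr0 ?mul0r ?addr0.
Qed.

Lemma mode_circle_integrable (n : nat) : circle_integrable (mode n).
Proof. exact: ccont_circle_integrable (mode_expi n) (ccont_wave _ _). Qed.

(** The factor -1 is kept explicit in order to match the form in which the
    linearity of operators is stated. *)
Definition mode_pair (a b : nat) : R[i] -> R[i] := fun w => -1 * mode b w + mode a w.

Lemma mode_pair_circle_integrable (a b : nat) : circle_integrable (mode_pair a b).
Proof.
rewrite (_ : mode_pair a b = (fun w => - mode b w + mode a w)).
  apply: circle_integrableD; last exact: mode_circle_integrable.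
  by apply: circle_integrableN; exact: mode_circle_integrable.
by apply/funext => w; rewrite /mode_pair mulN1r.
Qed.

Lemma esum_spike (n : nat) (c : R) : 0 <= c ->
  (\esum_(m in [set m : int | m != 0%R]) (if m == n then c%:E else 0) <= c%:E)%E.
Proof.
move=> c0; apply: ge_ereal_sup => _ [X [finX XD] <-].
have [nX|nX] := pselect (X (n : int)).
  rewrite (fsbigD1 (n : int))//= eqxx fsbig1 ?adde0// => i [_ /eqP/negbTE ->] //.
by rewrite fsbig1 ?lee_fin// => i Xi; case: eqP => // ni; rewrite ni in Xi.
Qed.

Lemma H12sq_mode_pair (a b : nat) : (0 < a)%N -> (0 < b)%N -> a != b ->
  (H12sq (mode_pair a b) <= 1)%E.
Proof.
move=> a0 b0 ab.
have half0 : 0 <= 1 / 2 :> R by [].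
apply: (@le_trans _ _ (\esum_(m in [set m : int | m != 0%R])
   ((if m == a then (1 / 2)%:E else 0) + (if m == b then (1 / 2)%:E else 0)))%E).
  apply: le_esum => m _.
  have -> : fourier (mode_pair a b) m = fourier (mode a) m - fourier (mode b) m.
    have cb := mode_circle_integrable b.
    rewrite addrC -fourierN// -fourierD; [|exact: circle_integrableN
                                          |exact: mode_circle_integrable].
    by congr (fourier _ m); apply/funext => w; rewrite /mode_pair mulN1r.
  rewrite !fourier_mode; have [->|ma] := eqVneq m a; have [e|mb] := eqVneq _ (b : int).
  - by case: e ab => ->; rewrite eqxx.
  - by rewrite subr0 adde0 cabs_real -normrX ger0_norm ?sqr_ge0// lee_fin mode_scale_sqr.
  - by rewrite e sub0r add0e cabsN cabs_real -normrX ger0_norm ?sqr_ge0// lee_fin mode_scale_sqr.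
  - by rewrite subr0 cabs0 expr0n mulr0 adde0.
rewrite esumD; last 2 first.
- by move=> m _; case: eqP => _ //; rewrite lee_fin.
- by move=> m _; case: eqP => _ //; rewrite lee_fin.
have -> : 1%E = ((1 / 2)%:E + (1 / 2)%:E)%E :> \bar R by rewrite -EFinD; congr (_%:E); field.
by apply: leeD; exact: esum_spike.
Qed.

Lemma H12sq_mode (n : nat) : (0 < n)%N -> (H12sq (mode n) <= 1)%E.
Proof.
move=> n0; apply: (@le_trans _ _ (1 / 2)%:E); last by rewrite lee_fin; lra.
apply: le_trans (esum_spike n (_ : 0 <= 1 / 2)) => //.
apply: le_esum => m _; rewrite fourier_mode; case: eqP => [->|_].
  by rewrite cabs_real -normrX ger0_norm ?sqr_ge0// lee_fin mode_scale_sqr.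
by rewrite cabs0 expr0n mulr0.
Qed.

Lemma H12sq_le1 u : circle_integrable u -> (H12sq u <= 1)%E ->
  H12 u /\ (H12norm u <= 1)%E.
Proof.
move=> ui u1; have n1 : (H12norm u <= 1)%E by rewrite H12norm_le// expr1n.
by split => //; split => //; apply: le_lt_trans n1 _; rewrite ltry.
Qed.

End DirichletSeminorm.

(** * Area of a twisted pair of oscillations *)

Section TwistedArea.
Context {R : realType}.
Variable t : R.
Implicit Types (x : R) (m n : int).

Local Notation phi x := (lift t x).
Local Notation dphi x := (1 + 2 * t * cos (2 * x)).

Lemma lift0 : phi 0 = 0.
Proof. by rewrite /lift mulr0 sin0 mulr0 addr0. Qed.

Lemma lift2pi : phi (2 * pi) = 2 * pi.
Proof. by rewrite /lift (@s_2pi R) mulr0 addr0. Qed.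

Definition phase m n x := m%:~R * phi x + n%:~R * x.

Lemma is_derive_phase m n x : is_derive x 1 (phase m n) (m%:~R * dphi x + n%:~R).
Proof.
have h := is_derive_lift t x; apply: is_derive_eq.
by rewrite /GRing.scale /=; ring.
Qed.

Lemma cont_lift : continuous (fun x => phi x).
Proof. exact: continuous_lift. Qed.

Lemma cont_phase m n : continuous (phase m n).
Proof.
have := cont_lift => ?.
by rewrite /phase; apply: cont_add; apply: cont_mul => //; continuity.
Qed.

Definition phase_dmean m n : R := avg (fun x => dphi x * cos (phase m n x)).
Definition phase_mean m n : R := avg (fun x => cos (phase m n x)).

Lemma cont_phase_dmean m n : continuous (fun x => dphi x * cos (phase m n x)).
Proof. by have ? := @cont_phase m n; apply: cont_mul; [continuity|exact: cont_cos]. Qed.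

Lemma cont_phase_mean m n : continuous (fun x => cos (phase m n x)).
Proof. by apply: cont_cos; exact: cont_phase. Qed.

(** The mean of the exact derivative $(\sin(m\phi+n\theta))'$ vanishes. *)
Lemma phase_avg m n : m%:~R * phase_dmean m n + n%:~R * phase_mean m n = 0.
Proof.
have iE := continuous_periodic_integrable (@cont_phase_dmean m n).
have iN := continuous_periodic_integrable (@cont_phase_mean m n).
have cE := @cont_phase_dmean m n; have cN := @cont_phase_mean m n.
rewrite /phase_dmean /phase_mean -!avgZ// -avgD; last 2 first.
- by apply: continuous_periodic_integrable; apply: cont_mul => //; exact: cont_cst.
- by apply: continuous_periodic_integrable; apply: cont_mul => //; exact: cont_cst.
apply: (@avg_derive0 _ (fun x => sin (phase m n x))).
- by apply: cont_add; apply: cont_mul => //; exact: cont_cst.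
- move=> x; have h := @is_derive1_comp R sin _ x _ _ (is_derive_sin _) (is_derive_phase m n x).
  by apply: (is_derive_eq h); ring.
- by rewrite /phase lift2pi lift0 -mulrDl -intrD sinMint_2pi !mulr0 addr0 sin0.
Qed.

Lemma phase_mean_le m n : `|phase_mean m n| <= 1.
Proof.
apply: normr_avg_le => [|x]; last exact: cos_max.
exact/continuous_periodic_integrable/cont_phase_mean.
Qed.

Lemma phase_dmean_le m n : `|t| < 1 / 4 -> `|phase_dmean m n| <= 3 / 2.
Proof.
move=> t4; apply: normr_avg_le => [|x].
  exact/continuous_periodic_integrable/cont_phase_dmean.
have h : `|dphi x| <= 3 / 2.
  have : `|2 * t * cos (2 * x)| <= 2 * `|t|.
    by rewrite !normrM normr_nat ler_piMr ?mulr_ge0// cos_max.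
  by have := ler_normD 1 (2 * t * cos (2 * x)); rewrite normr1; lra.
by rewrite normrM; apply: le_trans h; rewrite ler_piMr// cos_max.
Qed.

Lemma phase_mean_opp (a : nat) : phase_mean a (- a%:Z) = avg (fun x => cos (a%:R * `|t| * sin (2 * x))).
Proof.
apply: avg_ext => x; rewrite /phase /lift intrN mulNr.
have -> : a%:~R * (x + t * sin (2 * x)) - a%:~R * x = a%:R * t * sin (2 * x) by ring.
by have [t0|t0] := ger0P t => //; rewrite mulrN mulNr cosN.
Qed.

Variables (h : R[i] -> R[i]).
Hypothesis hE : forall x, h (expi x) = expi (lift t x).
Variables a b : nat.
Hypothesis (a0 : (0 < a)%N) (ab : (a < b)%N).

Local Notation ca := (@mode_scale R a).
Local Notation cb := (@mode_scale R b).

(** The area form applied to the difference of a twisted pair and the pair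
    itself. The four diagonal terms contribute 2; by the exactness of
    $(\sin(m\phi+n\theta))'$ what is left are the diagonal oscillatory integrals
    and terms with the small factor $a\,c_ac_b$. *)
Lemma twisted_area_le :
  ((2 - phase_mean a (- a%:Z) - phase_mean b (- b%:Z) +
    2 * (a%:R * ca * cb) * (phase_dmean a (- b%:Z) + phase_mean (- b%:Z) a))%:E <=
   H12sq (fun w => mode_pair a b (h w) - mode_pair a b w)%R)%E.
Proof.
have b0 : (0 < b)%N by exact: leq_ltn_trans ab.
pose u w := mode_pair a b (h w) - mode_pair a b w.
pose A x := a%:~R * phi x; pose B x := b%:~R * phi x.
pose C x := a%:~R * x : R; pose D x := b%:~R * x : R.
pose p x := ca * cos (A x) - cb * cos (B x) - ca * cos (C x) + cb * cos (D x).
pose q x := ca * sin (A x) - cb * sin (B x) - ca * sin (C x) + cb * sin (D x).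
pose p' x := - ca * (a%:~R * dphi x * sin (A x)) + cb * (b%:~R * dphi x * sin (B x))
  + ca * (a%:~R * sin (C x)) - cb * (b%:~R * sin (D x)).
pose q' x := ca * (a%:~R * dphi x * cos (A x)) - cb * (b%:~R * dphi x * cos (B x))
  - ca * (a%:~R * cos (C x)) + cb * (b%:~R * cos (D x)).
have uE x : u (expi x) = p x +i* q x.
  rewrite /u /mode_pair !hE !mode_expi /wave.
  by apply: complex_ext; rewrite !(ReD, ImD, ReN, ImN, ReM, ImM) /= /p /q /A /B /C /D; ring.
have cphi := cont_lift.
have dphiD x := is_derive_lift t x.
have dp x : is_derive x 1 p (p' x).
  by apply: is_derive_eq; rewrite /p' /A /B /C /D /GRing.scale /=; ring.
have dq x : is_derive x 1 q (q' x).
  by apply: is_derive_eq; rewrite /q' /A /B /C /D /GRing.scale /=; ring.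
have cA : continuous A by apply: cont_mul => //; exact: cont_cst.
have cB : continuous B by apply: cont_mul => //; exact: cont_cst.
have cC : continuous C by rewrite /C; continuity.
have cD : continuous D by rewrite /D; continuity.
have cp' : continuous p' by rewrite /p'; continuity.
have cq' : continuous q' by rewrite /q'; continuity.
have aG : trig_approximable (fun x => p x +i* q x).
  have -> : (fun x => p x +i* q x) = (fun x =>
     (wave ca%:C 0 x * expi (a%:~R * phi x) + wave (- cb)%:C 0 x * expi (b%:~R * phi x)) +
     (wave (- ca)%:C 0 x * expi (a%:~R * lift 0 x) + wave cb%:C 0 x * expi (b%:~R * lift 0 x))).
    apply/funext => x; rewrite /wave mul0r expi0 !mulr1 {3 4}/lift !mul0r !addr0.
    by apply: complex_ext; rewrite !(ReD, ImD, ReN, ImN, ReM, ImM) /= /p /q /A /B /C /D; ring.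
  by apply: trig_approximableD; apply: trig_approximableD;
    exact: trig_approximable_wave_lift.
have := area_le_H12sq uE dp dq cp' cq' aG; apply: le_trans.
rewrite lee_fin.
have ha : a%:R * ca ^+ 2 = 1 / 2 by exact: mode_scale_sqr.
have hb : b%:R * cb ^+ 2 = 1 / 2 by exact: mode_scale_sqr.
pose k := ca * cb * (a%:R + b%:R).
have cph m n := @cont_phase m n.
have c1 := cph a (- a%:Z); have c2 := cph b (- b%:Z).
have c3 := cph (a%:Z - b%:Z) 0; have c4 := cph 0 (a%:Z - b%:Z).
have c5 := cph a (- b%:Z); have c6 := cph (- b%:Z) a.
have -> : avg (fun x => p x * q' x - q x * p' x) =
  avg (fun x => (a%:R * ca ^+ 2 + b%:R * cb ^+ 2) * dphi x +
    (a%:R * ca ^+ 2 + b%:R * cb ^+ 2) * 1 +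
    (- (a%:R * ca ^+ 2)) * (dphi x * cos (phase a (- a%:Z) x)) +
    (- (a%:R * ca ^+ 2)) * cos (phase a (- a%:Z) x) +
    (- (b%:R * cb ^+ 2)) * (dphi x * cos (phase b (- b%:Z) x)) +
    (- (b%:R * cb ^+ 2)) * cos (phase b (- b%:Z) x) +
    (- k) * (dphi x * cos (phase (a%:Z - b%:Z) 0 x)) +
    (- k) * cos (phase 0 (a%:Z - b%:Z) x) +
    (ca * cb * a%:R) * (dphi x * cos (phase a (- b%:Z) x)) +
    (ca * cb * b%:R) * cos (phase a (- b%:Z) x) +
    (ca * cb * b%:R) * (dphi x * cos (phase (- b%:Z) a x)) +
    (ca * cb * a%:R) * cos (phase (- b%:Z) a x)).
  apply: avg_ext => x.
  have -> : phase a (- a%:Z) x = A x - C x by rewrite /phase intrN mulNr.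
  have -> : phase b (- b%:Z) x = B x - D x by rewrite /phase intrN mulNr.
  have -> : phase (a%:Z - b%:Z) 0 x = A x - B x.
    by rewrite /phase intrB mul0r addr0 mulrBl.
  have -> : phase 0 (a%:Z - b%:Z) x = C x - D x.
    by rewrite /phase intrB mul0r add0r mulrBl.
  have -> : phase a (- b%:Z) x = A x - D x by rewrite /phase intrN mulNr.
  have -> : phase (- b%:Z) a x = C x - B x by rewrite /phase intrN mulNr addrC.
  have hA : sin (A x) ^+ 2 = 1 - cos (A x) ^+ 2 := sin2cos2 _.
  have hB : sin (B x) ^+ 2 = 1 - cos (B x) ^+ 2 := sin2cos2 _.
  have hC : sin (C x) ^+ 2 = 1 - cos (C x) ^+ 2 := sin2cos2 _.
  have hD : sin (D x) ^+ 2 = 1 - cos (D x) ^+ 2 := sin2cos2 _.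
  rewrite !cosB /p /q /p' /q' /k; move: hA hB hC hD.
  rewrite -![(Posz _)%:~R]/(_%:R).
  set SA := sin (A x); set SB := sin (B x); set SC := sin (C x); set SD := sin (D x).
  set CA := cos (A x); set CB := cos (B x); set CC := cos (C x); set CD := cos (D x).
  set d := dphi x => hA hB hC hD.
  by ring: hA hB hC hD.
have intg f : continuous f -> periodic_integrable f by exact: continuous_periodic_integrable.
do 11! (rewrite avgD; [|by apply: intg; continuity|by apply: intg; continuity]).
rewrite !avgZ; try by apply: intg; continuity.
rewrite avg_cst -!/(phase_dmean _ _) -!/(phase_mean _ _).
have -> : avg (fun x => dphi x) = 1.
  rewrite (avg_derive _ (is_derive_lift t)); last by continuity.
  by rewrite lift2pi lift0 subr0 mulVf// lt0r_neq0// twopi_gt0.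
have iaa : phase_dmean a (- a%:Z) = phase_mean a (- a%:Z).
  have := phase_avg a (- a%:Z); rewrite intrN mulNr => /eqP; rewrite subr_eq0 => /eqP.
  by apply: mulfI; rewrite intr_eq0 -lt0n.
have ibb : phase_dmean b (- b%:Z) = phase_mean b (- b%:Z).
  have := phase_avg b (- b%:Z); rewrite intrN mulNr => /eqP; rewrite subr_eq0 => /eqP.
  by apply: mulfI; rewrite intr_eq0 -lt0n.
have nab : (a%:Z - b%:Z)%:~R != 0 :> R.
  by rewrite intr_eq0 subr_eq0 eqz_nat neq_ltn ab.
have i3 : phase_dmean (a%:Z - b%:Z) 0 = 0.
  have := phase_avg (a%:Z - b%:Z) 0; rewrite mul0r addr0 => /eqP.
  by rewrite mulf_eq0 (negbTE nab) => /eqP.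
have i4 : phase_mean 0 (a%:Z - b%:Z) = 0.
  have := phase_avg 0 (a%:Z - b%:Z); rewrite mul0r add0r => /eqP.
  by rewrite mulf_eq0 (negbTE nab) => /eqP.
have i5 : b%:R * phase_mean a (- b%:Z) = a%:R * phase_dmean a (- b%:Z).
  by have := phase_avg a (- b%:Z); rewrite intrN mulNr; lra.
have i6 : b%:R * phase_dmean (- b%:Z) a = a%:R * phase_mean (- b%:Z) a.
  by have := phase_avg (- b%:Z) a; rewrite intrN mulNr; lra.
rewrite iaa ibb i3 i4 ha hb.
have -> : ca * cb * b%:R * phase_mean a (- b%:Z) =
  ca * cb * a%:R * phase_dmean a (- b%:Z) by rewrite -!mulrA i5.
have -> : ca * cb * b%:R * phase_dmean (- b%:Z) a =
  ca * cb * a%:R * phase_mean (- b%:Z) a by rewrite -!mulrA i6.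
by rewrite le_eqVlt; apply/orP; left; apply/eqP; field.
Qed.

End TwistedArea.

(** * The essential norm *)

Section EssentialNorm.
Context {R : realType}.

Lemma twisted_pair_circle_integrable (t : R) (h : R[i] -> R[i]) (a b : nat) :
  (forall x, h (expi x) = expi (lift t x)) ->
  circle_integrable (fun w => mode_pair a b (h w) - mode_pair a b w).
Proof.
move=> hE; apply: circle_integrableD; last first.
  exact/circle_integrableN/mode_pair_circle_integrable.
pose G x := wave (-1 * (mode_scale b)%:C) 0 x * expi (b%:~R * lift t x) +
            wave (mode_scale a)%:C 0 x * expi (a%:~R * lift t x) : R[i].
apply: (@ccont_circle_integrable _ _ G) => [x|].
  rewrite hE /mode_pair !mode_expi /G /wave mul0r expi0 !mulr1 mulrA.
  by [].
have cl := @cont_lift R t.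
have c n : continuous (fun x => n%:~R * lift t x).
  by apply: cont_mul => //; exact: cont_cst.
have cz (z : R[i]) (n : int) : ccont (fun x => wave z 0 x * expi (n%:~R * lift t x)).
  apply: (ccont_parts (p := fun x => complex.Re z * cos (n%:~R * lift t x) -
                                     complex.Im z * sin (n%:~R * lift t x))
                      (q := fun x => complex.Re z * sin (n%:~R * lift t x) +
                                     complex.Im z * cos (n%:~R * lift t x))).
  - by move=> x; rewrite /wave mul0r expi0 mulr1 ReM.
  - by move=> x; rewrite /wave mul0r expi0 mulr1 ImM.
  - by have ? := c n; continuity.
  - by have ? := c n; continuity.
exact: ccontD.
Qed.

(** A compact operator is nearly constant on some pair of widely separated
    modes, because a subsequence of their images is Cauchy. *)
Lemma compact_mode_pair (K : (R[i] -> R[i]) -> (R[i] -> R[i])) (n0 : nat)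
    (M d : R) : compact_operator K -> (0 < n0)%N -> 0 < d ->
  exists a b : nat, [/\ (n0 <= a)%N, (a < b)%N, M * a%:R <= b%:R &
    (H12sq (K (mode_pair a b)) <= (8 * d)%:E)%E].
Proof.
move=> [[KH KL _] Kc] n00 d0.
have modeH n : (0 < n)%N -> H12 (@mode R n).
  by move=> n1; have [] := H12sq_le1 (@mode_circle_integrable R n) (H12sq_mode n1).
have [phi [v [phi_incr vH Kv]]] : exists phi : nat -> nat, exists v : R[i] -> R[i],
   [/\ {homo phi : m n / (m < n)%N}, H12 v &
       H12norm (fun w => K (mode (phi n + n0)) w - v w) @[n --> \oo] --> 0%E].
  apply: (Kc (fun n => mode (n + n0))) => n.
  by apply: H12sq_le1; [exact: mode_circle_integrable|apply: H12sq_mode; rewrite addn_gt0 n00 orbT].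
have phi_ge n : (n <= phi n)%N.
  by elim: n => // n IH; apply: (leq_ltn_trans IH); exact: phi_incr.
have sd : 0 < Num.sqrt d by rewrite sqrtr_gt0.
have [N _ hN] : \forall n \near \oo,
    (H12norm (fun w => K (mode (phi n + n0)) w - v w)%R < (Num.sqrt d)%:E)%E.
  exact: (Kv _ (nbhs_open_ereal_lt (f := fun=> Num.sqrt d) sd)).
have small n : (N <= n)%N ->
    (H12sq (fun w => K (mode (phi n + n0)) w - v w)%R <= d%:E)%E.
  move=> Nn; have := ltW (hN n Nn).
  by rewrite (H12norm_le _ (ltW sd)) (sqr_sqrtr (ltW d0)).
(* [b] comes so much later in the subsequence that [M * a <= b]. *)
pose a := (phi N + n0)%N.
pose j := (N.+1 + Num.bound (`|M| * a%:R))%N.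
pose b := (phi j + n0)%N.
have a0 : (0 < a)%N by rewrite addn_gt0 n00 orbT.
have Nj : (N < j)%N by rewrite /j addSn ltnS leq_addr.
have ab : (a < b)%N by rewrite ltn_add2r; exact: phi_incr.
have b0 : (0 < b)%N by exact: leq_ltn_trans ab.
have na : (n0 <= a)%N by rewrite leq_addl.
have Mab : M * a%:R <= b%:R.
  apply: (@le_trans _ _ (`|M| * a%:R)); first by rewrite ler_wpM2r// ler_norm.
  apply/ltW/(lt_le_trans (archi_boundP _)); first by rewrite mulr_ge0.
  rewrite ler_nat; apply: leq_trans (leq_addr _ _).
  by apply: leq_trans (phi_ge j); rewrite /j leq_addl.
have sa := small N (leqnn N); have sb := small j (ltnW Nj).
rewrite -/a in sa; rewrite -/b in sb; clearbody a b.
exists a, b; split => //.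
have [Kai _] := KH _ (modeH a a0); have [Kbi _] := KH _ (modeH b b0).
have [vi _] := vH.
pose fa w := K (mode a) w - v w; pose fb w := K (mode b) w - v w.
have fai : circle_integrable fa by exact/circle_integrableD/circle_integrableN.
have fbi : circle_integrable fb by exact/circle_integrableD/circle_integrableN.
pose D w := fa w + - fb w.
have Di : circle_integrable D by exact/circle_integrableD/circle_integrableN.
have two : (1 + 1 = 2 :> R) by ring.
have HD : (H12sq D <= (4 * d)%:E)%E.
  apply: le_trans (H12sqD ltr01 fai (circle_integrableN fbi)) _.
  rewrite H12sqN// invr1 two.
  have -> : (4 * d)%:E = (2%:E * d%:E + 2%:E * d%:E)%E :> \bar R.
    by rewrite -!EFinM -EFinD; congr (_%:E); ring.
  by apply: leeD; (apply: lee_wpmul2l; first by rewrite lee_fin); [exact: sa|exact: sb].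
have anb : a != b by rewrite neq_ltn ab.
have [xi _] := H12sq_le1 (@mode_pair_circle_integrable R a b)
  (H12sq_mode_pair a0 b0 anb).
have [Kxi _] := KH _ xi.
pose E w := K (mode_pair a b) w - (-1 * K (mode b) w + K (mode a) w).
have E0 : H12sq E = 0%E.
  have := KL (-1) _ _ (modeH b b0) (modeH a a0).
  rewrite -/(mode_pair a b) -/E H12normE => e.
  by rewrite -[LHS]sqr_sqrte ?H12sq_ge0// e expe2 mule0.
have EE : E = (fun w => K (mode_pair a b) w + - D w).
  by apply/funext => w; rewrite /E /D /fa /fb; ring.
have Ei : circle_integrable E.
  by rewrite EE; exact/circle_integrableD/circle_integrableN.
have -> : K (mode_pair a b) = (fun w => E w + D w).
  by apply/funext => w; rewrite EE subrK.
apply: le_trans (H12sqD ltr01 Ei Di) _.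
rewrite E0 mule0 add0e invr1 two.
have -> : (8 * d)%:E = (2%:E * (4 * d)%:E)%E :> \bar R.
  by rewrite -EFinM; congr (_%:E); ring.
by apply: lee_wpmul2l => //; rewrite lee_fin.
Qed.

(** Here $C$ stands for the squared operator norm; $7e$ bounds the defect of the
    area form and $16e$ the contribution of the compact operator. *)
Lemma lower_bound_of_perturbed (C : R) :
  (forall e, 0 < e -> e < 1 -> 2 - 7 * e <= (1 + e) * C + 16 * e) -> 2 <= C.
Proof.
move=> H; rewrite leNgt; apply/negP => C2.
pose e := Num.min (1 / 2) ((2 - C) / 50).
have e1 : e <= 1 / 2 by rewrite ge_min lexx.
have e2 : e <= (2 - C) / 50 by rewrite ge_min lexx orbT.
have e0 : 0 < e by rewrite lt_min divr_gt0//= divr_gt0// subr_gt0.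
have := H e e0 (le_lt_trans e1 _); have : e * C <= e * 2 by rewrite ler_pM2l// ltW.
have h : 1 / 2 < 1 :> R by lra.
by move=> h1 /(_ h); lra.
Qed.

Lemma essential_norm_ge (t : R) (h : R[i] -> R[i]) : `|t| < 1 / 4 -> t != 0 ->
  (forall x, h (expi x) = expi (lift t x)) ->
  ((Num.sqrt 2)%:E <=
    essential_norm (fun u w => (composition_operator h u w - u w)%R))%E.
Proof.
move=> t4 t0 hE; apply: le_ereal_inf_tmp => _ [K Kc <-].
set N := operator_norm _.
have tp : 0 < `|t| by rewrite normr_gt0.
have below a b : (0 < a)%N -> (a < b)%N ->
    (H12norm (fun w => (mode_pair a b (h w) - mode_pair a b w) - K (mode_pair a b) w)%R <= N)%E.
  move=> a0 ab; have b0 : (0 < b)%N by exact: leq_ltn_trans ab.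
  apply: ereal_sup_ubound; exists (mode_pair a b) => //.
  apply: H12sq_le1; first exact: mode_pair_circle_integrable.
  by apply: H12sq_mode_pair => //; rewrite neq_ltn ab.
have N0 : (0 <= N)%E.
  by apply: le_trans (below 1%N 2%N _ _) => //; rewrite H12normE sqrte_ge0.
have [->|Noo] := eqVneq N +oo%E; first by rewrite leey.
have Nfin : N \is a fin_num by rewrite ge0_fin_numE// ltey.
rewrite -(fineK Nfin) lee_fin; set c := fine N.
have c0 : 0 <= c by rewrite /c fine_ge0.
suff c2 : 2 <= c ^+ 2.
  by rewrite -[leRHS](ger0_norm c0) -sqrtr_sqr ler_sqrt// exprn_ge0.
apply: lower_bound_of_perturbed => e e0 e1.
have [L hL] := oscillatory_avg_small e0.
pose n0 := (Num.bound (`|L| / `|t|)).+1.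
have osc n : (n0 <= n)%N -> phase_mean t n (- n%:Z) <= e.
  move=> nn; rewrite phase_mean_opp; apply: le_trans (ler_norm _) _.
  apply: hL; apply: le_trans (ler_norm L) _.
  rewrite -ler_pdivrMr//; apply/ltW/(lt_le_trans (archi_boundP _)).
    by rewrite divr_ge0.
  by rewrite ler_nat; apply: leq_trans nn; exact: leqnSn.
have e20 : 0 < e ^+ 2 by rewrite exprn_gt0.
have [a [b [na ab Mab Kx]]] := compact_mode_pair (e ^- 2) Kc (ltn0Sn _ : (0 < n0)%N) e20.
have a0 : (0 < a)%N by apply: leq_trans na.
have b0 : (0 < b)%N by exact: leq_ltn_trans ab.
have A := twisted_area_le hE a0 ab.
have [[_ KL _] _] := Kc; have [[KH _ _] _] := Kc.
have xH : H12 (@mode_pair R a b).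
  apply: (H12sq_le1 (mode_pair_circle_integrable a b) _).1.
  by apply: H12sq_mode_pair => //; rewrite neq_ltn ab.
have [Kxi _] := KH _ xH.
have Txi := twisted_pair_circle_integrable a b hE.
have Bn := below a b a0 ab.
rewrite -(fineK Nfin) H12norm_le// in Bn.
set T := (fun w => mode_pair a b (h w) - mode_pair a b w) in A Txi.
have TE : T = (fun w => (T w - K (mode_pair a b) w) + K (mode_pair a b) w).
  by apply/funext => w; rewrite subrK.
have TKi : circle_integrable (fun w => T w - K (mode_pair a b) w).
  exact/circle_integrableD/circle_integrableN.
have := le_trans A _; rewrite {1}TE => /(_ _ (H12sqD e0 TKi Kxi)) {}A.
have : ((1 + e)%R%:E * H12sq (fun w => T w - K (mode_pair a b) w)%R +
        (1 + e^-1)%R%:E * H12sq (K (mode_pair a b)) <=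
       ((1 + e) * c ^+ 2 + (1 + e^-1) * (8 * e ^+ 2))%R%:E)%E.
  rewrite (EFinD ((1 + e) * c ^+ 2)) (EFinM (1 + e)) (EFinM (1 + e^-1)).
  apply: leeD; apply: lee_wpmul2l => //; rewrite lee_fin.
    by rewrite addr_ge0// ltW.
  by rewrite addr_ge0// invr_ge0 ltW.
move=> /(le_trans A); rewrite lee_fin => {}A.
(* With [d := e ^+ 2] in [compact_mode_pair] the compact term is of order [e]. *)
have e8 : (1 + e^-1) * (8 * e ^+ 2) = 8 * e ^+ 2 + 8 * e by field; exact: lt0r_neq0.
have ee : e ^+ 2 <= e by rewrite expr2 ler_piMr ?ltW.
(* The square of the left-hand side is [a / (4 * b)]. *)
have r_le : `|a%:R * mode_scale a * mode_scale b| <= e.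
  have sb := mode_scale_sqr (R := R) b0; have sa := mode_scale_sqr (R := R) a0.
  rewrite -(@ler_pXn2r _ 2) ?nnegrE ?normr_ge0 ?(ltW e0)// real_normK ?num_real//.
  have -> : (a%:R * mode_scale a * mode_scale b) ^+ 2 =
     a%:R * (a%:R * mode_scale a ^+ 2) * mode_scale b ^+ 2 :> R by ring.
  rewrite sa.
  have bR : 0 < b%:R :> R by rewrite ltr0n.
  have sbE : mode_scale b ^+ 2 = (1 / 2) / b%:R :> R.
    by rewrite -sb mulrC mulKf// lt0r_neq0.
  rewrite sbE mulrA ler_pdivrMr//.
  have : a%:R <= e ^+ 2 * b%:R.
    by rewrite -ler_pdivrMl// .
  have : 0 <= a%:R :> R by [].
  lra.
have hE5 := phase_dmean_le a (- b%:Z) t4; have hN6 := phase_mean_le t (- b%:Z) a.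
have cross : `|2 * (a%:R * mode_scale a * mode_scale b) *
    (phase_dmean t a (- b%:Z) + phase_mean t (- b%:Z) a)| <= 5 * e.
  rewrite normrM normrM normr_nat.
  have -> : 5 * e = 2 * e * (5 / 2) by field.
  apply: ler_pM; rewrite ?mulr_ge0//.
    by rewrite ler_wpM2l.
  by apply: le_trans (ler_normD _ _) _; lra.
have oa := osc a na; have ob := osc b (leq_trans na (ltnW ab)).
move: cross A; rewrite ler_norml e8 => /andP[h1 h2] A.
by move: h1 A; set X := 2 * _ * _; lra.
Qed.

End EssentialNorm.

Theorem proposition2p6 (R : realType) (h : R -> R[i] -> R[i])
  (h_def : forall t x : R, `|t| < 1 / 4 ->
     h t (expi x) = expi (x + t * sin (2 * x))) :
  [/\ forall t : R, `|t| < 1 / 4 -> quasisymmetric (h t) /\ normalized (h t),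
      teichmuller_distance (h t) id @[t --> (0 : R)] --> (0%E : \bar R) &
      ((Num.sqrt 2)%:E <=
       lime_inf (fun t : R =>
         essential_norm (fun u w => (composition_operator (h t) u w - u w)%R)) 0)%E].
Proof.
have hE t : `|t| < 1 / 4 -> forall x, h t (expi x) = expi (lift t x).
  by move=> t4 x; exact: h_def.
split.
- move=> t t4; split.
    exact: circle_map_quasisymmetric t4 (hE t t4).
  exact: circle_map_normalized (hE t t4).
- by apply: teichmuller_distance_cvg0 => t x t4; exact: hE.
- rewrite /lime_inf leeNr; apply: ereal_inf_le.
  exists (ereal_sup [set (- essential_norm
      (fun u w => (composition_operator (h t) u w - u w)%R))%E | t in
      [set t : R | `|t| < 1 / 4 /\ t != 0]]).
    exists [set t : R | `|t| < 1 / 4 /\ t != 0] => //.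
    have N : \forall t \near (0 : R), `|t| < 1 / 4 by apply: nbhs0_lt; rewrite divr_gt0.
    by apply: filterS N => t t4 t0.
  apply: ge_ereal_sup => _ [t [t4 t0] <-]; rewrite leeN2.
  exact: essential_norm_ge t4 t0 (hE t t4).
Qed.
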